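(* Let $k$, $D=(V,A)$, $\mathcal{L}$, $D^+$ and the notation of the context be given. Let $H\subseteq A$ be an inclusionwise minimal set of arcs containing at least one arc of every $\mathcal{L}$-tight $k$-arborescence of $D^+$, let $D'=D^+-H$, and let $W$ be an inclusionwise minimal member of $\mathcal{L}$ for which $D'_W$ does not contain an $\mathcal{L}[W]$-tight $s_W$-rooted $k$-arborescence. Then every arc of $H$ has both ends in $W$, and there is an $\mathcal{L}[W]$-compatible subpartition $\mathcal{X}$ of $W$ such that \[\sum_{X\in\mathcal{X}} r^\oplus_{D',W}(\delta^{in}_{D'[W]}(X))=k(|\mathcal{X}|-1)-1.\]
   Context: $k$ is a positive integer, $D=(V,A)$ a digraph, $\mathcal{L}\subseteq 2^V$ a laminar family containing $V$ and all singletons, and $D$ contains an $\mathcal{L}$-tight $k$-arborescence. (A $k$-arborescence is the arc-disjoint union of $k$ spanning arborescences, i.e. spanning trees in the undirected sense with all in-degrees at most one; it is $r$-rooted if all are rooted at $r$; for a family $\mathcal{K}$ of node sets, a $k$-arborescence $F$ of a digraph $G$ is $\mathcal{K}$-tight if for every $U\in\mathcal{K}$ the arcs of $F$ inside $U$ form a $k$-arborescence of $G[U]$.) $D^+$ is obtained from $D$ by adding a node $s$ and $|A|+k$ parallel arcs from $s$ to each $v\in V$. For $U\in\mathcal{L}$, $\mathcal{L}[U]=\{U'\in\mathcal{L}:U'\subseteq U\}$. For a digraph $G$ obtained from $D^+$ by deleting arcs, $G_U$ is obtained from $G$ by contracting $V+s-U$ into a node $s_U$ and deleting loops (arcs leaving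 $s_U$ identified with arcs of $G$ entering $U$); if $G_U$ contains an $\mathcal{L}[U]$-tight $s_U$-rooted $k$-arborescence, $r_{G,U}$ is the rank function of the matroid on $\delta^{in}_G(U)$ whose bases are the $k$-element sets extendable to an $\mathcal{L}[U]$-tight $s_U$-rooted $k$-arborescence of $G_U$. For non-singleton $W\in\mathcal{L}$ let $W_1,\dots,W_l$ be the maximal members of $\mathcal{L}[W]-\{W\}$; a set $X\subseteq W$ is $\mathcal{L}[W]$-compatible if it is a union of some of the $W_i$, and a subpartition (collection of pairwise disjoint nonempty sets) of $W$ is $\mathcal{L}[W]$-compatible if all its members are. For arc sets $E$ whose arcs enter some $W_i$, $r^\oplus_{G,W}(E)=\sum_{i=1}^l r_{G,W_i}(E\cap\delta^{in}_{D^+}(W_i))$ (well defined here for $G=D'$ by minimality of $W$). $\delta^{in}_{D'[W]}(X)$ is the set of arcs of the induced subdigraph $D'[W]$ entering $X$. *)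

(* Defs.v *)
From HB Require Import structures.
From mathcomp Require Import all_boot all_order all_algebra.

Set Implicit Arguments.
Unset Strict Implicit.
Unset Printing Implicit Defensive.

(* Finite digraphs, parallel arcs allowed, given by a set of nodes and a set of
   arcs inside ambient finite types; subgraphs, contractions, etc. of a digraph
   thereby share its arcs. *)
Record digraph (V A : finType) := Digraph {
  src : A -> V;
  tgt : A -> V;
  nodes : {set V};
  arcs : {set A};
  arcs_ends : forall a, a \in arcs -> (src a \in nodes) && (tgt a \in nodes)
}.

Section Digraphs.
Variables (V A : finType).
Implicit Types (k : nat) (G : digraph V A) (X U : {set V}) (T F H : {set A}).

Definition in_arcs G X : {set A} :=
  [set a in arcs G | (src G a \notin X) && (tgt G a \in X)].

Lemma induced_ends G U a :
  a \in [set a in arcs G | (src G a \in U) && (tgt G a \in U)] ->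
  (src G a \in nodes G :&: U) && (tgt G a \in nodes G :&: U).
Proof.
by rewrite !inE => /and3P[/arcs_ends/andP[-> ->] -> ->].
Qed.

Definition induced G U : digraph V A := Digraph (@induced_ends G U).

Lemma del_arcs_ends G H a :
  a \in arcs G :\: H -> (src G a \in nodes G) && (tgt G a \in nodes G).
Proof. by rewrite inE => /andP[_ /arcs_ends]. Qed.

Definition del_arcs G H : digraph V A := Digraph (@del_arcs_ends G H).

(* A pair (a, b) is the arc a traversed forwards if b = true and backwards if
   b = false. *)
Definition dtail G (d : A * bool) : V := if d.2 then src G d.1 else tgt G d.1.
Definition dhead G (d : A * bool) : V := if d.2 then tgt G d.1 else src G d.1.

Definition circuit G T (c : seq (A * bool)) : bool :=
  [&& all (fun d => d.1 \in T) c, cycle (fun d e => dhead G d == dtail G e) c,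
      uniq [seq d.1 | d <- c] & uniq [seq dtail G d | d <- c]].

(* The arcs of a circuit are distinct, so its length is at most #|A|. *)
Definition acyclic G T : bool :=
  [forall n : 'I_#|A|, forall c : n.+1.-tuple (A * bool), ~~ circuit G T c].

Definition adjacent G T : rel V := fun u v =>
  [exists a in T, ((src G a == u) && (tgt G a == v))
               || ((src G a == v) && (tgt G a == u))].

Definition connected G T : bool :=
  [forall u in nodes G, forall v in nodes G, connect (adjacent G T) u v].

Definition spanning_tree G T : bool :=
  [&& T \subset arcs G, connected G T & acyclic G T].

Definition arborescence G T : bool :=
  spanning_tree G T &&
  [forall v in nodes G, #|[set a in T | tgt G a == v]| <= 1].

Definition rooted_arborescence (r : V) G T : bool :=
  [&& arborescence G T, r \in nodes G & [forall a in T, tgt G a != r]].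

Definition disjoint_union_of (k : nat) (P : pred {set A}) F : bool :=
  [exists T : {ffun 'I_k -> {set A}},
    [&& [forall i, P (T i)],
        [forall i, forall j, (i != j) ==> [disjoint T i & T j]]
      & F == \bigcup_i T i]].

Definition k_arborescence k G F : bool :=
  disjoint_union_of k (arborescence G) F.

Definition rooted_k_arborescence k r G F : bool :=
  disjoint_union_of k (rooted_arborescence r G) F.

Definition tight k (K : {set {set V}}) G F : bool :=
  [forall U in K, k_arborescence k (induced G U) (F :&: arcs (induced G U))].

End Digraphs.

Section Laminar.
Variable V : finType.
Implicit Types (L P : {set {set V}}) (U W X : {set V}).

Definition laminar L : Prop :=
  forall X Y, X \in L -> Y \in L ->
  [|| [disjoint X & Y], X \subset Y | Y \subset X].

Definition below L U : {set {set V}} := [set X in L | X \subset U].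

Definition max_parts L W : {set {set V}} :=
  [set X | maxset (fun Y => Y \in below L W :\ W) X].

Definition compatible L W X : bool :=
  (X \subset W) && [exists P : {set {set V}},
    (P \subset max_parts L W) && (X == cover P)].

Definition subpartition W P : bool :=
  [&& trivIset P, set0 \notin P & cover P \subset W].

Definition compatible_subpartition L W P : bool :=
  subpartition W P && [forall X in P, compatible L W X].

End Laminar.

(* Node sets and families of node sets of D, viewed in digraphs on V + s, where
   s is None. *)
Definition up (V : finType) (X : {set V}) : {set option V} := Some @: X.
Definition upF (V : finType) (K : {set {set V}}) : {set {set option V}} :=
  [set up X | X in K].

Section Plus.
Variables (V A : finType) (D : digraph V A) (k : nat).

Definition plus_arc : finType := (A + V * 'I_(#|arcs D| + k))%type.

Definition plus_src (a : plus_arc) : option V :=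
  match a with inl a => Some (src D a) | inr _ => None end.

Definition plus_tgt (a : plus_arc) : option V :=
  match a with inl a => Some (tgt D a) | inr p => Some p.1 end.

Definition plus_nodes : {set option V} := None |: up (nodes D).

Definition plus_arcs : {set plus_arc} :=
  [set a | match a with inl a => a \in arcs D | inr p => p.1 \in nodes D end].

Lemma plus_ends a : a \in plus_arcs ->
  (plus_src a \in plus_nodes) && (plus_tgt a \in plus_nodes).
Proof.
rewrite /plus_nodes /up inE.
by case: a => [a /arcs_ends/andP[sa ta]|p hp] /=; rewrite !inE !imset_f ?orbT.
Qed.

Definition plus_graph : digraph (option V) plus_arc := Digraph plus_ends.

End Plus.

Section Contraction.
Variables (V B : finType).
Implicit Types (k : nat) (G : digraph (option V) B) (U : {set V}) (L : {set {set V}}).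

(* The node obtained by contracting everything outside U is again called None;
   as s lies outside U, this name is free. *)
Definition contract_node U (x : option V) : option V :=
  if x \in up U then x else None.

Definition contract_src G U a := contract_node U (src G a).
Definition contract_tgt G U a := contract_node U (tgt G a).

Definition contract_nodes G U : {set option V} :=
  [set contract_node U x | x in nodes G].

Definition contract_arcs G U : {set B} :=
  [set a in arcs G | contract_src G U a != contract_tgt G U a].

Lemma contract_ends G U a : a \in contract_arcs G U ->
  (contract_src G U a \in contract_nodes G U) &&
  (contract_tgt G U a \in contract_nodes G U).
Proof.
by rewrite inE => /andP[/arcs_ends/andP[sa ta] _]; apply/andP; split; apply: imset_f.
Qed.

Definition contract G U : digraph (option V) B := Digraph (@contract_ends G U).

Definition tight_rooted k L G U (F : {set B}) : bool :=
  rooted_k_arborescence k None (contract G U) F &&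
  tight k (upF (below L U)) (contract G U) F.

Definition has_tight_rooted k L G U : bool :=
  [exists F : {set B}, tight_rooted k L G U F].

Definition is_base k L G U (b : {set B}) : bool :=
  [&& b \subset in_arcs G (up U), #|b| == k
    & [exists F : {set B}, tight_rooted k L G U F && (b \subset F)]].

(* Meaningful when has_tight_rooted k L G U holds, otherwise 0. *)
Definition rank k L G U (E : {set B}) : nat :=
  \max_(I : {set B} | (I \subset E) &&
                      [exists b : {set B}, is_base k L G U b && (I \subset b)])
    #|I|.

End Contraction.

Section Blocking.
Variables (V A : finType) (D : digraph V A) (k : nat) (L : {set {set V}}).

Definition rank_sum (G : digraph (option V) (plus_arc D k)) (W : {set V})
    (E : {set plus_arc D k}) : nat :=
  \sum_(U in max_parts L W) rank k L G U (E :&: in_arcs (plus_graph D k) (up U)).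

Definition blocking (H : {set A}) : bool :=
  (H \subset arcs D) &&
  [forall F : {set plus_arc D k},
    (k_arborescence k (plus_graph D k) F && tight k (upF L) (plus_graph D k) F) ==>
    [exists a in H, inl a \in F]].

Definition plus_minus (H : {set A}) : digraph (option V) (plus_arc D k) :=
  del_arcs (plus_graph D k) [set inl a | a in H].

End Blocking.

(* Main.v *)
(* Call an arc set tight in U if it lies in U plus arcs entering U, enters every
   nonempty subset of U at least k times and every member of L[U] exactly k
   times; by Edmonds' disjoint branching theorem these are the L[U]-tight rooted
   k-arborescences.  Contracting the parts W_i of W, a k-subset b of the arcs
   entering W extends to a tight arc set iff r^oplus(delta(X)) >= k for every
   nonempty union X of parts, computed with b and the arcs inside W.  Since
   X |-> r^oplus(delta(X)) is submodular, the least number of arcs entering W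
   that must be added to meet all these demands equals the maximum over
   compatible subpartitions of sum_X (k - r^oplus(delta(X))).  By induction on L
   this gives the exchange property of the bases, and shows that deleting one arc
   changes the ranks by at most one.  As W is infeasible in D' the maximum there
   is at least k + 1; as restoring any arc of H makes W feasible it is at most
   k + 1, which is the asserted equality. *)
Require Import Defs.
From HB Require Import structures.
From mathcomp Require Import all_boot all_order all_algebra.
From mathcomp Require Import zify.

Set Implicit Arguments.
Unset Strict Implicit.
Unset Printing Implicit Defensive.

Import GRing.Theory.

(** * Cuts, disjoint branchings and arborescences *)

Section Cuts.
Variables (N B : finType) (s t : B -> N).
Implicit Types (F T : {set B}) (X Y U R : {set N}).

(** Packings of arborescences are awkward to exchange, numbers of arcs entering sets are not; hence
    packings are traded for cut conditions at the outset, and contractions vanish too, since they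
    change no cut of a set inside [U]. The min-max formula comes from deleting root arcs greedily:
    what remains is optimal because tight sets uncross. It serves three times, with root arcs taken
    from another base (exchange), from a base for a smaller arc set (effect of one arc on the
    ranks), and from [s] (the final equality). Restoring an arc of [H] gains one in total, not one
    for each member of the subpartition, because only the part containing its head gains rank and
    the members are disjoint. That [H] lies inside [W] has a separate reason: a restored arc
    entering [W] could be replaced by a parallel arc from [s]. The copies suffice, as at most [k]
    arcs of a packing enter [W] and [H] contains no arc from [s]. *)

Definition delta X : {set B} := [set a | (s a \notin X) && (t a \in X)].

Lemma delta_submod F X Y :
  #|F :&: delta (X :&: Y)| + #|F :&: delta (X :|: Y)| <=
  #|F :&: delta X| + #|F :&: delta Y|.
Proof.
rewrite -cardsUI -[leqRHS]cardsUI; apply: leq_add; apply/subset_leq_card/subsetP=> a;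
by rewrite !inE; case: (a \in F); case: (s a \in X); case: (s a \in Y);
   case: (t a \in X); case: (t a \in Y).
Qed.

Section Packing.
Variables (r : N) (U : {set N}).
Hypothesis rU : r \notin U.

(* Lovasz's proof: grow [T] so that the remaining arcs still enter every set
   [k] times.  If the next arc is blocked, some set not inside the reached part
   [R] is tight; in a smallest such set an arc leaving [R] can be added. *)
Lemma spanning_branching k F :
  (forall a, a \in F -> (s a \in r |: U) && (t a \in U)) ->
  (forall X, X \subset U -> X != set0 -> k < #|F :&: delta X|) ->
  exists T : {set B}, [/\ T \subset F,
    forall X, X \subset U -> X != set0 -> 0 < #|T :&: delta X| &
    forall X, X \subset U -> X != set0 -> k <= #|(F :\: T) :&: delta X|].
Proof.
move=> endF cutF.
suff grow n R T : #|U :\: R| < n -> R \subset U -> T \subset F ->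
    (forall a, a \in T -> t a \in R) ->
    (forall X, X \subset U -> X :&: R != set0 -> 0 < #|T :&: delta X|) ->
    (forall X, X \subset U -> X != set0 -> k <= #|(F :\: T) :&: delta X|) ->
    exists T : {set B}, [/\ T \subset F,
      forall X, X \subset U -> X != set0 -> 0 < #|T :&: delta X| &
      forall X, X \subset U -> X != set0 -> k <= #|(F :\: T) :&: delta X|].
  apply: (grow #|U|.+1 set0 set0); rewrite ?setD0 ?sub0set //.
  - by move=> a; rewrite inE.
  - by move=> X; rewrite setI0 eqxx.
  - by move=> X sX nX; apply/ltnW/cutF.
elim: n R T => // n IH R T; rewrite ltnS => leR sRU sTF hT enterT restT.
have [eqRU|nRU] := eqVneq (U :\: R) set0.
  have sUR : U \subset R by rewrite -setD_eq0 eqRU.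
  exists T; split=> // X sX nX; apply: enterT => //.
  by rewrite (setIidPl (subset_trans sX sUR)).
suff [a [aF aT saR taR tightN]] : exists a, [/\ a \in F, a \notin T, s a \in r |: R,
    t a \in U :\: R & forall X, X \subset U -> a \in delta X ->
      k < #|(F :\: T) :&: delta X|].
  move: (taR); rewrite inE => /andP[tanR taU].
  apply: (IH (t a |: R) (a |: T)).
  - apply: leq_trans leR; apply: proper_card; apply/properP; split.
      by apply/setDS/subsetUr.
    by exists (t a) => //; rewrite !inE eqxx.
  - by rewrite subUset sub1set taU.
  - by rewrite subUset sub1set aF.
  - by move=> b; rewrite !inE => /orP[/eqP->|/hT ->]; rewrite ?eqxx ?orbT.
  - move=> X sX nX; have [XR0|nXR] := eqVneq (X :&: R) set0; last first.
      by apply: leq_trans (enterT X sX nXR) _; apply/subset_leq_card/setSI/subsetUr.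
    have notR v : v \in X -> v \notin R.
      by move=> vX; apply/negP=> vR; have := in_set0 v; rewrite -XR0 inE vX vR.
    have taX : t a \in X.
      case/set0Pn: nX => v; rewrite !inE => /andP[vX /orP[/eqP <-//|vR]].
      by have := notR v vX; rewrite vR.
    apply/card_gt0P; exists a; rewrite !inE eqxx taX andbT /=.
    move: saR; rewrite !inE => /orP[/eqP->|saR].
      by apply: contra rU => /(subsetP sX).
    by apply/negP=> /notR; rewrite saR.
  - move=> X sX nX.
    have -> : (F :\: (a |: T)) :&: delta X = ((F :\: T) :&: delta X) :\ a.
      by apply/setP=> b; rewrite !inE; case: (b == a); case: (b \in T); case: (b \in F).
    have := cardsD1 a ((F :\: T) :&: delta X).
    case: (boolP (a \in _)) => [|_]; last by rewrite add0n => <-; apply: restT.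
    rewrite in_setI => /andP[_ /(tightN X sX)]; clear; lia.
pose tight X := [&& X \subset U, X :\: R != set0 & #|(F :\: T) :&: delta X| == k].
(* Every arc of [T] has its head in [R], so the cut of a set disjoint from [R] has lost no arc. *)
have sameD X : (F :\: T) :&: delta (X :\: R) = F :&: delta (X :\: R).
  apply/setP=> b; rewrite !inE; case: (boolP (b \in T)) => //= /hT ->.
  by rewrite !andbF.
have sDU X : X \subset U -> X :\: R \subset U by apply/subset_trans/subsetDl.
have ngt X : X \subset U -> X :\: R != set0 -> ~~ tight X ->
    k < #|(F :\: T) :&: delta X|.
  move=> sX nX; rewrite /tight sX nX /= ltn_neqAle eq_sym => -> /=; apply: restT => //.
  by apply: contra nX => /eqP->; rewrite set0D.
have outR a X : t a \in U :\: R -> a \in delta X -> X :\: R != set0.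
  rewrite !inE => /andP[tR _] /andP[_ tX]; apply/set0Pn; exists (t a).
  by rewrite inE tR.
have [X0 tX0|noT] := pickP tight; last first.
  have /card_gt0P[a] := leq_trans (ltn0Sn _) (cutF _ (sDU U (subxx _)) nRU).
  rewrite in_setI => /andP[aF aD].
  have taR : t a \in U :\: R by move: aD; rewrite inE => /andP[].
  exists a; split=> //.
  - by apply: contraTN taR => /hT; rewrite inE => ->.
  - have /andP[+ _] := endF a aF; move: aD; rewrite !inE.
    by case: (s a == r) => //= /andP[+ _] saU; rewrite saU andbT negbK.
  - by move=> X sX aX; apply: ngt => //; [exact: outR aX | rewrite noT].
case: (arg_minnP (fun X => #|X|) tX0) => X tX minX.
case/and3P: (tX) => sX nX /eqP eX.
have /subsetPn[a] : ~~ (F :&: delta (X :\: R) \subset (F :\: T) :&: delta X).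
  apply/negP=> /subset_leq_card; rewrite eX leqNgt cutF //.
  exact: sDU.
rewrite -sameD in_setI => /andP[aFT aD]; rewrite in_setI aFT /= => naX.
move: (aFT); rewrite inE => /andP[aT aF].
move: (aD); rewrite !inE => /andP[saXR /andP[taR taX]].
have saX : s a \in X by move: naX; rewrite inE taX andbT negbK.
have saR : s a \in R by move: saXR; rewrite saX andbT negbK.
exists a; split=> //.
- by rewrite inE saR orbT.
- by rewrite inE taR (subsetP sX).
- move=> Y sY aY; apply: ngt => //.
    by apply: outR aY; rewrite inE taR (subsetP sX).
  apply/negP=> tY; case/and3P: (tY) => _ _ /eqP eY.
  move: aY; rewrite inE => /andP[saY taY].
  (* A tight [Y] entered by [a] would uncross with [X] into a tight set missing the tail of [a],
     against the choice of [X]. *)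
  have tXY : tight (X :&: Y).
    apply/and3P; split; first exact: subset_trans (subsetIl _ _) sX.
      by apply/set0Pn; exists (t a); rewrite !inE taR taX.
    have nI : X :&: Y != set0 by apply/set0Pn; exists (t a); rewrite inE taX.
    have nXY : X :|: Y != set0 by apply/set0Pn; exists (t a); rewrite inE taX.
    have sXY : X :|: Y \subset U by rewrite subUset sX.
    have := delta_submod (F :\: T) X Y; rewrite eX eY.
    have := restT _ sXY nXY; have := restT _ (subset_trans (subsetIl X Y) sX) nI.
    by clear; lia.
  have := minX _ tXY; rewrite leqNgt => /negP; apply; apply: proper_card.
  rewrite properE subsetIl; apply/subsetPn; exists (s a) => //.
  by rewrite inE saX.
Qed.

(** Edmonds' disjoint branchings: they are split off one at a time, and the rest still enters every
    set often enough for the remaining ones. *)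
Lemma branching_packing k F :
  (forall a, a \in F -> (s a \in r |: U) && (t a \in U)) ->
  (forall X, X \subset U -> X != set0 -> k <= #|F :&: delta X|) ->
  exists T : {ffun 'I_k -> {set B}}, [/\ forall i, T i \subset F,
    forall i j, i != j -> [disjoint T i & T j] &
    forall i X, X \subset U -> X != set0 -> 0 < #|T i :&: delta X|].
Proof.
elim: k F => [|k IH] F endF cutF.
  by exists [ffun=> set0]; split; case.
have [T0 [sT0 enterT0 restT0]] := spanning_branching endF cutF.
have [a|T [sT disjT enterT]] := IH (F :\: T0) _ restT0.
  by rewrite inE => /andP[_]; apply: endF.
exists [ffun i => if unlift ord0 i is Some j then T j else T0]; split.
- move=> i; rewrite ffunE; case: unliftP => // j _.
  exact: subset_trans (sT j) (subsetDl _ _).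
- have T0T j : [disjoint T0 & T j].
    rewrite disjoint_sym; apply: disjointWl (sT j) _.
    by rewrite -setI_eq0; apply/eqP/setP=> a; rewrite !inE; case: (a \in T0); rewrite ?andbF.
  move=> i j; rewrite !ffunE; case: unliftP => [i'|] ->; case: unliftP => [j'|] ->.
  + by rewrite (inj_eq lift_inj); apply: disjT.
  + by rewrite disjoint_sym.
  + by [].
  + by rewrite eqxx.
- move=> i X sX nX; rewrite ffunE; case: unliftP => [j|] _; first exact: enterT.
  exact: enterT0.
Qed.

End Packing.

Lemma card_disjoint_family k (T : 'I_k -> {set B}) Z :
  (forall i j, i != j -> [disjoint T i & T j]) ->
  \sum_i #|T i :&: Z| = #|\bigcup_i T i :&: Z|.
Proof.
move=> disjT; rewrite -[RHS]sum1_card.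
have -> : \bigcup_i T i :&: Z = \bigcup_i (T i :&: Z) by rewrite big_distrl.
rewrite partition_disjoint_bigcup.
  by apply: eq_bigr => i _; rewrite sum1_card.
by move=> i j /disjT; apply: disjointW; rewrite subsetIl.
Qed.

End Cuts.

(** * In-degrees, connectivity and circuits of arborescences *)

Section Arborescences.
Variables (N A : finType) (Q : digraph N A).
Implicit Types (T : {set A}) (X : {set N}).

Definition indeg T v := #|[set a in T | tgt Q a == v]|.

Lemma indeg_le1P T v a b : indeg T v <= 1 -> a \in T -> b \in T ->
  tgt Q a = v -> tgt Q b = v -> a = b.
Proof.
by move=> /card_le1_eqP h aT bT ta tb; apply: h; rewrite inE ?aT ?bT ?ta ?tb eqxx.
Qed.

Definition dstep T : rel N := fun u v => [exists a in T, (src Q a == u) && (tgt Q a == v)].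

Lemma adjacent_sym T : symmetric (adjacent Q T).
Proof.
by move=> u v; apply/existsP/existsP=> -[a /andP[aT h]]; exists a; rewrite aT orbC.
Qed.

(* The set of nodes reached from [r] by directed paths is closed under adjacency:
   an arc from a node [w] into a reached node [u] is the only arc into [u], so it
   is the one through which [u] was reached. *)
Lemma connected_enters T r X : T \subset arcs Q -> connected Q T ->
  (forall v, v \in nodes Q -> indeg T v <= 1) ->
  r \in nodes Q -> (forall a, a \in T -> tgt Q a != r) ->
  X \subset nodes Q -> r \notin X -> X != set0 ->
  0 < #|T :&: delta (src Q) (tgt Q) X|.
Proof.
move=> sT conT deg rN rT sX rX /set0Pn[v vX].
have reach u : u \in nodes Q -> connect (dstep T) r u.
  move=> uN; have conu : connect (adjacent Q T) r u.
    by move/forallP: conT => /(_ r)/implyP/(_ rN)/forallP/(_ u)/implyP; apply.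
  suff clos : closed (adjacent Q T) [pred w | connect (dstep T) r w].
    by have := closed_connect clos conu; rewrite !inE connect0 => <-.
  apply: intro_closed; first exact/sym_connect_sym/adjacent_sym.
  move=> x y /existsP[a /andP[aT /orP[]/andP[/eqP sa /eqP ta]]]; rewrite !inE => rx.
    apply: connect_trans rx (connect1 _); apply/existsP; exists a.
    by rewrite aT sa ta !eqxx.
  case/connectP: rx => p; case/lastP: p => [_ /= xr|p z].
    by move: (rT a aT); rewrite ta xr eqxx.
  rewrite rcons_path last_rcons => /andP[pp /existsP[b /andP[bT /andP[/eqP sb /eqP tb]]]] xz.
  have xN : x \in nodes Q by rewrite -ta; case/andP: (arcs_ends (subsetP sT _ aT)).
  have ab : a = b by apply: (indeg_le1P (deg x xN)) => //; rewrite tb.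
  by apply/connectP; exists p => //; rewrite -sa ab sb.
have := reach v (subsetP sX _ vX) => /connectP[p].
elim: p r rX {rN rT reach} => [|w p IH] r rX /= => [_ vr|]; first by rewrite -vr vX in rX.
move=> /andP[/existsP[a /andP[aT /andP[/eqP sa /eqP ta]]] pp] lst.
have [wX|wX] := boolP (w \in X); last exact: (IH w).
by apply/card_gt0P; exists a; rewrite !inE aT sa rX ta.
Qed.

(** At most one node is the target of no arc: starting from such a node [u], connectivity forces an
    arc into any other node [v]. This bound on the arcs inside a set later limits the arcs entering
    it. *)
Lemma connected_card T : T \subset arcs Q -> connected Q T ->
  (forall v, v \in nodes Q -> indeg T v <= 1) -> #|nodes Q| <= #|T|.+1.
Proof.
move=> sT conT deg; pose Z := nodes Q :\: [set tgt Q a | a in T].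
have ZT u a : u \in Z -> a \in T -> tgt Q a != u.
  rewrite inE => /andP[nu _] aT; apply: contra nu => /eqP <-; exact: imset_f.
have Z1 : #|Z| <= 1.
  apply/card_le1_eqP => u v uZ vZ; apply/eqP; apply: contraT => uv.
  have uN : u \in nodes Q by move: uZ; rewrite inE => /andP[].
  have vN : v \in nodes Q by move: vZ; rewrite inE => /andP[].
  have := @connected_enters T u [set v] sT conT deg uN (fun a => @ZT u a uZ).
  rewrite sub1set vN in_set1 eq_sym uv => /(_ isT isT) h.
  have /card_gt0P[a] : 0 < #|T :&: delta (src Q) (tgt Q) [set v]|.
    by apply: h; apply/set0Pn; exists v; rewrite inE.
  rewrite !inE => /and3P[aT _ /eqP ta].
  by have := ZT v a vZ aT; rewrite ta eqxx.
rewrite -(cardsID [set tgt Q a | a in T]) addnC -[#|T|.+1]add1n; apply: leq_add => //.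
by apply: leq_trans (leq_imset_card (tgt Q) T); apply/subset_leq_card/subsetIr.
Qed.

(** The delicate point is acyclicity, as circuits are undirected. A circuit has as many arcs as
    nodes and in-degrees are at most one, so its arcs have all its nodes as targets. The cut
    condition yields an arc entering its node set from outside, which would be a second arc into one
    of these nodes. *)
Lemma arborescence_intro T r : T \subset arcs Q -> r \in nodes Q ->
  (forall v, v \in nodes Q -> indeg T v <= 1) ->
  (forall a, a \in T -> tgt Q a != r) ->
  (forall X, X \subset nodes Q -> r \notin X -> X != set0 ->
    0 < #|T :&: delta (src Q) (tgt Q) X|) ->
  rooted_arborescence r Q T.
Proof.
move=> sT rN deg rT enter.
have reach v : v \in nodes Q -> connect (adjacent Q T) r v.
  move=> vN; apply: contraT => nv.
  pose X := [set u in nodes Q | ~~ connect (adjacent Q T) r u].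
  have : 0 < #|T :&: delta (src Q) (tgt Q) X|.
    apply: enter; first by apply/subsetP=> u; rewrite inE => /andP[].
      by rewrite inE connect0 andbF.
    by apply/set0Pn; exists v; rewrite inE vN.
  case/card_gt0P=> a; rewrite !inE => /andP[aT].
  have /andP[-> ->] := arcs_ends (subsetP sT _ aT).
  rewrite negbK => /andP[ra /negP[]]; apply: connect_trans ra (connect1 _).
  by apply/existsP; exists a; rewrite aT !eqxx.
have csym := sym_connect_sym (adjacent_sym T).
apply/and3P; split=> //; last by apply/forallP=> a; apply/implyP/rT.
apply/andP; split; last by apply/forallP=> v; apply/implyP/deg.
apply/and3P; split=> //.
  apply/forallP=> u; apply/implyP=> uN; apply/forallP=> v; apply/implyP=> vN.
  by apply: connect_trans (reach v vN); rewrite csym reach.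
apply/forallP=> n; apply/forallP=> c; apply/negP=> /and4P[/allP cT cyc ua ut].
pose Vc := [set dtail Q d | d in (c : seq _)].
pose Ac := [set d.1 | d in (c : seq _)].
have AT a : a \in Ac -> a \in T by case/imsetP=> d dc ->; apply: cT.
have tailV d : d \in (c : seq _) -> dtail Q d \in Vc by move=> dc; apply: imset_f.
have headV d : d \in (c : seq _) -> dhead Q d \in Vc.
  by move=> dc; have /eqP-> := next_cycle cyc dc; apply: tailV; rewrite mem_next.
have endsV a : a \in Ac -> (src Q a \in Vc) && (tgt Q a \in Vc).
  case/imsetP=> -[b []] dc -> /=.
    by rewrite (tailV _ dc) (headV _ dc).
  by rewrite (tailV _ dc) (headV _ dc).
have TN a : a \in T -> tgt Q a \in nodes Q.
  by move/(subsetP sT)/arcs_ends/andP=> [].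
have tinj : {in Ac &, injective (tgt Q)}.
  move=> a b /AT aT /AT bT e; exact: (indeg_le1P (deg _ (TN b bT))).
have cardV : #|Vc| = size c.
  rewrite -(size_map (dtail Q)) -(card_uniqP ut).
  by apply: eq_card => v; apply/imsetP/mapP=> -[d]; exists d.
have cardA : #|Ac| = size c.
  rewrite -(size_map (@fst _ _)) -(card_uniqP ua).
  by apply: eq_card => v; apply/imsetP/mapP=> -[d]; exists d.
have tA : [set tgt Q a | a in Ac] = Vc.
  apply/eqP; rewrite eqEcard card_in_imset // cardV cardA leqnn andbT.
  by apply/subsetP=> _ /imsetP[a /endsV/andP[_ ta] ->].
have Vt v : v \in Vc -> exists2 a, a \in Ac & v = tgt Q a.
  by rewrite -tA => /imsetP[a aA ->]; exists a.
have : 0 < #|T :&: delta (src Q) (tgt Q) Vc|.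
  apply: enter.
  - by apply/subsetP=> v /Vt[a /AT/TN + ->].
  - by apply/negP=> /Vt[a /AT/rT + e]; rewrite e eqxx.
  - by rewrite -card_gt0 cardV size_tuple.
case/card_gt0P=> a; rewrite !inE => /and3P[aT saV /Vt[b bA tb]].
have ab : a = b.
  by apply: (indeg_le1P (deg _ (TN b (AT b bA)))) => //; apply: AT.
by move: saV; rewrite ab; case/andP: (endsV b bA) => ->.
Qed.

(** If every node were the target of an arc, walking from [v0] back along such arcs would repeat a
    node and close a circuit. *)
Lemma acyclic_root T v0 : T \subset arcs Q -> acyclic Q T -> v0 \in nodes Q ->
  exists2 r, r \in nodes Q & forall a, a \in T -> tgt Q a != r.
Proof.
move=> sT acT v0N.
have [r /andP[rN /forallP rT]|noroot] :=
  pickP (fun r => (r \in nodes Q) && [forall a, (a \in T) ==> (tgt Q a != r)]).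
  by exists r => // a aT; have := rT a; rewrite aT.
have par v : {a | v \in nodes Q -> a \in T /\ tgt Q a = v}.
  case: (pickP (fun a => (a \in T) && (tgt Q a == v))) => [a /andP[aT /eqP ta]|no].
    by exists a.
  case vN: (v \in nodes Q).
    exfalso; have := noroot v; rewrite vN => /negbT; rewrite negb_forall.
    by move=> /existsP[a]; rewrite negb_imply negbK no.
  have a0 : {a : A | a \in T}.
    have := noroot v0; rewrite v0N /= => /negbT; rewrite negb_forall.
    by move=> /existsP h; have /sigW[a] := h; rewrite negb_imply => /andP[aT _]; exists a.
  by case: a0 => a _; exists a.
pose pa v := sval (par v); pose p v := src Q (pa v).
have paT v : v \in nodes Q -> pa v \in T /\ tgt Q (pa v) = v by apply: (svalP (par v)).
have pN v : v \in nodes Q -> p v \in nodes Q.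
  by case/paT=> /(subsetP sT)/arcs_ends/andP[].
have iN n v : v \in nodes Q -> iter n p v \in nodes Q by move=> vN; elim: n => //= n; apply: pN.
have /trajectP[i lti e] := looping_order p v0.
set y := iter i p v0 in e.
have yN : y \in nodes Q by apply: iN.
have cyc : fcycle p (orbit p y).
  apply/(orbitPcycle 0 3) => //; exists (order p v0 - i).-1.
  by rewrite prednK ?subn_gt0 // /y -iterD subnK // ltnW.
(* Arcs are traversed backwards, so that the tails of the traversed arcs are the nodes of the
   orbit. *)
pose c := [seq (pa v, false) | v <- orbit p y].
have oN v : v \in orbit p y -> v \in nodes Q.
  by rewrite -fconnect_orbit => /iter_findex <-; apply: iN.
have uc : uniq [seq d.1 | d <- c].
  rewrite -map_comp map_inj_in_uniq ?orbit_uniq // => u v /oN/paT[_ tu] /oN/paT[_ tv] /= e'.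
  by rewrite -tu e' tv.
have lec : size c <= #|A|.
  by rewrite -(size_map (@fst _ _)) -(card_uniqP uc) max_card.
have gtc : 0 < size c by rewrite size_map size_orbit order_gt0.
have sc : size c == (size c).-1.+1 by rewrite prednK.
have ltc : (size c).-1 < #|A| by rewrite prednK.
exfalso; move/forallP: acT => /(_ (Ordinal ltc))/forallP/(_ (Tuple sc))/negP; apply.
have tl : [seq dtail Q d | d <- c] = orbit p y.
  rewrite -map_comp -[RHS]map_id; apply/eq_in_map => v /oN/paT[_ tv].
  by rewrite /= /dtail /= tv.
apply/and4P; split=> //=.
- by apply/allP=> _ /mapP[v /oN/paT[aT _] ->].
- rewrite cycle_map; have aN : all (mem (nodes Q)) (orbit p y) by apply/allP=> v /oN.
  apply: (sub_in_cycle _ aN) cyc => u v uN vN /=.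
  by rewrite /dhead /dtail /=; case: (paT v vN) => _ ->.
- by rewrite tl orbit_uniq.
Qed.

End Arborescences.

(** * Tight rooted k-arborescences as cut conditions *)

Section Up.
Variable V : finType.
Implicit Types (X Y : {set V}).

Lemma mem_up X v : (Some v \in up X) = (v \in X).
Proof. by rewrite mem_imset //; apply: Some_inj. Qed.

Lemma None_up X : (None \in up X) = false.
Proof. by apply/imsetP=> -[]. Qed.

Lemma upS X Y : (up X \subset up Y) = (X \subset Y).
Proof.
apply/subsetP/subsetP=> h; first by move=> v; rewrite -!mem_up; apply: h.
by case=> [v|]; rewrite ?None_up // !mem_up; apply: h.
Qed.

Lemma upI X Y : up (X :&: Y) = up X :&: up Y.
Proof. by apply/setP=> -[v|]; rewrite !inE ?None_up // !mem_up inE. Qed.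

Lemma upU X Y : up (X :|: Y) = up X :|: up Y.
Proof. by apply/setP=> -[v|]; rewrite !inE ?None_up // !mem_up inE. Qed.

Lemma up_eq0 X : (up X == set0) = (X == set0).
Proof. by rewrite -!cards_eq0 card_imset //; apply: Some_inj. Qed.

Lemma card_up X : #|up X| = #|X|.
Proof. by rewrite card_imset //; apply: Some_inj. Qed.

Lemma up_sub (Z : {set option V}) Y : Z \subset up Y -> exists2 X : {set V}, X \subset Y & Z = up X.
Proof.
move=> sZ; exists [set v | Some v \in Z].
  by apply/subsetP=> v; rewrite inE => /(subsetP sZ); rewrite mem_up.
apply/setP=> -[v|]; first by rewrite mem_up inE.
by rewrite None_up; apply/negbTE/negP=> /(subsetP sZ); rewrite None_up.
Qed.

End Up.

Lemma sum_le1 k (f : 'I_k -> nat) :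
  (forall i, 0 < f i) -> \sum_i f i <= k -> forall i, f i <= 1.
Proof.
move=> f_gt0 le i; move: le; rewrite (bigD1 i) //=.
have : \sum_(j < k | j != i) 1 <= \sum_(j < k | j != i) f j by apply: leq_sum => j _.
have : \sum_(j < k) 1 = k by rewrite sum1_card card_ord.
rewrite (bigD1 i) //= => e le1 le2.
rewrite -(leq_add2r (\sum_(j < k | j != i) 1)) e; apply: leq_trans le2.
by rewrite leq_add2l.
Qed.

Section Numeric.
Variables (V B : finType) (k : nat) (L : {set {set V}}).
Implicit Types (s t : B -> option V) (E F : {set B}) (U X : {set V}).

(* By Edmonds' theorem these cut conditions characterise the [L[U]]-tight rooted
   k-arborescences. *)
Definition tk s t E U F :=
  [&& F \subset E, [forall a in F, (t a \in up U) && (s a != t a)],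
      [forall X : {set V}, (X \subset U) && (X != set0) ==>
         (k <= #|F :&: delta s t (up X)|)]
    & [forall X in L, (X \subset U) && (X != set0) ==>
         (#|F :&: delta s t (up X)| <= k)]].

Lemma tkP s t E U F : reflect [/\ F \subset E,
    forall a, a \in F -> (t a \in up U) /\ (s a != t a),
    forall X, X \subset U -> X != set0 -> k <= #|F :&: delta s t (up X)| &
    forall X, X \in L -> X \subset U -> X != set0 -> #|F :&: delta s t (up X)| <= k]
  (tk s t E U F).
Proof.
apply: (iffP and4P) => -[sF endF ge le]; split=> //.
- by move=> a aF; apply/andP; move/forallP: endF => /(_ a); rewrite aF.
- by move=> X sX nX; move/forallP: ge => /(_ X); rewrite sX nX.
- by move=> X XL sX nX; move/forallP: le => /(_ X); rewrite XL sX nX.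
- by apply/forallP=> a; apply/implyP=> /endF[-> ->].
- by apply/forallP=> X; apply/implyP=> /andP[]; apply: ge.
- by apply/forallP=> X; apply/implyP=> XL; apply/implyP=> /andP[]; apply: le.
Qed.

Section Translation.
Variables (Q : digraph (option V) B) (U : {set V}).
Hypothesis nodesQ : nodes Q = None |: up U.
Hypothesis singL : forall v, v \in U -> [set v] \in L.
Local Notation dl X := (delta (src Q) (tgt Q) (up X)).

Lemma card_arcs_into F X : \sum_(v in X) #|[set a in F | tgt Q a == Some v]| =
  #|F :&: [set a | tgt Q a \in up X]|.
Proof.
rewrite -[RHS]sum1_card (partition_big (tgt Q) (mem (up X))) /=; last first.
  by move=> a; rewrite !inE => /andP[].
rewrite /up big_imset /=; last by move=> ? ? _ _; apply: Some_inj.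
apply: eq_bigr => v vX; rewrite sum1_card; apply: eq_card => a; rewrite [RHS]unfold_in /= !inE.
by case: eqP => [->|]; rewrite ?andbF ?andbT // (mem_imset _ _ (@Some_inj _)) vX andbT.
Qed.

Lemma card_inner_cut F X : #|F :&: [set a | tgt Q a \in up X]| =
  #|[set a in F | (src Q a \in up X) && (tgt Q a \in up X)]| + #|F :&: dl X|.
Proof.
rewrite -(cardsID [set a | src Q a \in up X]); congr (_ + _); apply: eq_card => a;
by rewrite !inE; case: (a \in F); case: (src Q a \in up X); case: (tgt Q a \in up X).
Qed.

(** The upper bound on a cut comes from counting: the nodes of [X] receive at most [k * #|X|] arcs,
    of which at least [k * #|X| - k] start in [X]. *)
Lemma tk_intro F : F \subset arcs Q -> (forall a, a \in F -> tgt Q a \in up U) ->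
  (forall X, X \subset U -> X != set0 -> k <= #|F :&: dl X|) ->
  (forall v, v \in U -> #|[set a in F | tgt Q a == Some v]| <= k) ->
  (forall X, X \in L -> X \subset U -> X != set0 ->
    k * #|X| <= #|[set a in F | (src Q a \in up X) && (tgt Q a \in up X)]| + k) ->
  tk (src Q) (tgt Q) (arcs Q) U F.
Proof.
move=> sF tU ge deg innerF.
apply/tkP; split=> //.
  move=> a aF; split; first exact: tU.
  (* A loop at [v] would use up in-degree without entering [[set v]], leaving fewer than [k] arcs in
     that cut. *)
  apply/eqP=> st; have := tU a aF; case ta: (tgt Q a) => [v|]; rewrite ?None_up // mem_up => vU.
  have v1 : [set v] \subset U by rewrite sub1set.
  have v0 : [set v] != set0 by apply/set0Pn; exists v; rewrite inE.
  have := ge _ v1 v0; rewrite leqNgt => /negP; apply.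
  apply: leq_trans (deg v vU); apply: proper_card; apply/properP; split.
    apply/subsetP=> b; rewrite !inE => /and3P[-> _] /=.
    by case: (tgt Q b) => [w|]; rewrite ?None_up // mem_up inE.
  exists a; first by rewrite inE aF ta eqxx.
  by rewrite !inE st ta mem_up inE eqxx andbF.
move=> X XL sX nX.
have : \sum_(v in X) #|[set a in F | tgt Q a == Some v]| <= k * #|X|.
  by rewrite mulnC -sum_nat_const; apply: leq_sum => v vX; apply/deg/(subsetP sX).
rewrite card_arcs_into card_inner_cut => le2.
by rewrite -(leq_add2l #|[set a in F | (src Q a \in up X) && (tgt Q a \in up X)]|)
  (leq_trans le2) ?innerF.
Qed.

(** Each of the [k] arborescences enters every nonempty set. Inside a member of [L], tightness
    supplies [k] connected subgraphs of in-degree at most one, hence enough inner arcs for the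
    counting in [tk_intro]. *)
Lemma tight_rooted_tk F :
  rooted_k_arborescence k None Q F -> tight k (upF (below L U)) Q F ->
  tk (src Q) (tgt Q) (arcs Q) U F.
Proof.
case/existsP=> T /and3P[/forallP arbT /forallP disjT /eqP eF] tightF.
have {}disjT i j : i != j -> [disjoint T i & T j].
  by move=> ij; move/forallP: (disjT i) => /(_ j); rewrite ij.
have arb i : [/\ T i \subset arcs Q, connected Q (T i),
    forall v, v \in nodes Q -> indeg Q (T i) v <= 1 &
    forall a, a \in T i -> tgt Q a != None].
  case/and3P: (arbT i) => /andP[/and3P[sT cT _] /forallP deg] _ /forallP rT; split=> //.
    by move=> v vN; have := deg v; rewrite vN.
  by move=> a aT; have := rT a; rewrite aT.
have rN : None \in nodes Q by rewrite nodesQ !inE.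
have sF : F \subset arcs Q by rewrite eF; apply/bigcupsP=> i _; case: (arb i).
have tU a : a \in F -> tgt Q a \in up U.
  move=> aF; have /andP[_] := arcs_ends (subsetP sF _ aF); rewrite nodesQ !inE => /orP[/eqP tN|//].
  by move: aF; rewrite eF => /bigcupP[i _ aT]; case: (arb i) => _ _ _ /(_ a aT); rewrite tN.
have ge X : X \subset U -> X != set0 -> k <= #|F :&: dl X|.
  move=> sX nX; rewrite eF -card_disjoint_family // -[X in X <= _]card_ord -sum1_card.
  apply: leq_sum => i _; case: (arb i) => sT cT deg rT.
  apply: (connected_enters sT cT deg rN rT); rewrite ?None_up ?up_eq0 //.
  by rewrite nodesQ; apply: subset_trans (subsetUr _ _); rewrite upS.
have deg v : v \in U -> #|[set a in F | tgt Q a == Some v]| <= k.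
  move=> vU; rewrite setIdE eF -card_disjoint_family // -[X in _ <= X]card_ord -sum1_card.
  apply: leq_sum => i _; case: (arb i) => _ _ dg _.
  by rewrite -setIdE; apply: dg; rewrite nodesQ !inE mem_up vU.
apply: tk_intro => // X XL sX nX.
have : k_arborescence k (induced Q (up X)) (F :&: arcs (induced Q (up X))).
  move/forallP: tightF => /(_ (up X))/implyP; apply.
  by apply: imset_f; rewrite inE XL.
case/existsP=> T' /and3P[/forallP arbT' /forallP disjT' /eqP eF'].
have {}disjT' i j : i != j -> [disjoint T' i & T' j].
  by move=> ij; move/forallP: (disjT' i) => /(_ j); rewrite ij.
have nX' : nodes (induced Q (up X)) = up X.
  by apply/setIidPr; rewrite nodesQ; apply: subset_trans (subsetUr _ _); rewrite upS.
have cardI : k * #|X| <= #|F :&: arcs (induced Q (up X))| + k.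
  rewrite eF' -[\bigcup_i _]setIT -card_disjoint_family //.
  rewrite mulnC -sum_nat_const -[X in _ <= _ + X]card_ord -sum1_card -big_split /=.
  rewrite sum_nat_const mulnC -[X in X * _ <= _](card_ord k) -sum_nat_const.
  apply: leq_sum => i _; rewrite setIT addn1 -card_up -nX'.
  case/andP: (arbT' i) => /and3P[sT cT _] /forallP dg.
  by apply: connected_card => // v vN; have := dg v; rewrite vN.
have -> : [set a in F | (src Q a \in up X) && (tgt Q a \in up X)] =
          F :&: arcs (induced Q (up X)).
  apply/setP=> a; rewrite !inE; case aF: (a \in F) => //=.
  by rewrite (subsetP sF).
exact: cardI.
Qed.

(** Each of the [k] branchings given by Edmonds' theorem enters every nonempty member of [L] below
    [U]; as only [k] arcs do, each enters it exactly once. On singletons this bounds the in-degrees;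
    on larger members the head of the unique entering arc is the root of the arborescence inside. *)
Lemma tk_tight_rooted F : tk (src Q) (tgt Q) (arcs Q) U F ->
  rooted_k_arborescence k None Q F /\ tight k (upF (below L U)) Q F.
Proof.
case/tkP=> sF endF ge le.
have NU : None \notin up U by rewrite None_up.
have [a aF|Z sZ nZ|T [sT disjT enterT]] := @branching_packing _ _ (src Q) (tgt Q) None (up U) NU k F.
- have [-> _] := endF a aF; rewrite andbT -nodesQ.
  by case/andP: (arcs_ends (subsetP sF _ aF)).
- have [X sX eZ] := up_sub sZ; rewrite eZ; apply: ge => //.
  by rewrite -up_eq0 -eZ.
have enter i X : X \subset U -> X != set0 -> 0 < #|T i :&: dl X|.
  by move=> sX nX; apply: enterT; rewrite ?upS ?up_eq0.
have le1 i X : X \in L -> X \subset U -> X != set0 -> #|T i :&: dl X| <= 1.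
  move=> XL sX nX; move: i; apply: sum_le1 => [i|]; first exact: enter.
  rewrite card_disjoint_family //; apply: leq_trans (le X XL sX nX).
  by apply/subset_leq_card/setSI/bigcupsP=> i _; apply: sT.
have v1 v : v \in U -> [set v] \subset U by rewrite sub1set.
have v0 (v : V) : [set v] != set0 by apply/set0Pn; exists v; rewrite inE.
have inv a v : a \in F -> (tgt Q a == Some v) = (a \in dl [set v]).
  move=> aF; have [_] := endF a aF; rewrite inE.
  case: (tgt Q a) => [w|] st; last by rewrite None_up andbF.
  rewrite mem_up inE; apply/eqP/andP=> [[<-]|[_ /eqP->//]]; split=> //.
  by apply: contraNN st; case: (src Q a) => [u|]; rewrite ?None_up // mem_up inE => /eqP->.
(* The branchings already use up the [k] arcs of [F] entering each singleton, so no arc of [F] is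
   left over. *)
have eF : F = \bigcup_i T i.
  apply/eqP; rewrite eqEsubset; apply/andP; split; last by apply/bigcupsP=> i _; apply: sT.
  apply/subsetP=> a aF; have [taU _] := endF a aF.
  case ta: (tgt Q a) taU => [v|]; rewrite ?None_up // mem_up => vU.
  have : \bigcup_i T i :&: dl [set v] = F :&: dl [set v].
    apply/eqP; rewrite eqEcard; apply/andP; split.
      by apply/setSI/bigcupsP=> i _; apply: sT.
    apply: leq_trans (le _ (singL vU) (v1 v vU) (v0 v)) _.
    rewrite -card_disjoint_family // -[X in X <= _]card_ord -sum1_card.
    by apply: leq_sum => i _; apply: enter; rewrite ?v1.
  by move/setP=> /(_ a); rewrite !in_setI -inv // ta eqxx aF !andbT => ->.
have deg i v : v \in nodes Q -> indeg Q (T i) v <= 1.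
  rewrite nodesQ !inE => /orP[/eqP->|].
    rewrite /indeg (_ : [set _ in _ | _] = set0) ?cards0 //; apply/setP=> a; rewrite !inE.
    by apply/negP=> /andP[/(subsetP (sT i))/endF[ta _] /eqP e]; rewrite e None_up in ta.
  case: v => [v|]; rewrite ?None_up // mem_up => vU.
  apply: leq_trans (le1 i _ (singL vU) (v1 v vU) (v0 v)).
  apply/subset_leq_card/subsetP=> a; rewrite in_setI !inE => /andP[aT ta].
  by have := inv a v (subsetP (sT i) _ aT); rewrite ta aT inE => <-.
split.
  apply/existsP; exists T; apply/and3P; split.
  - apply/forallP=> i; apply: arborescence_intro.
    + exact: subset_trans (sT i) sF.
    + by rewrite nodesQ !inE.
    + exact: deg.
    + by move=> a /(subsetP (sT i))/endF[+ _]; apply: contraTneq => ->; rewrite None_up.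
    + move=> Z sZ rZ nZ; apply: enterT => //; apply/subsetP=> x xZ.
      have := subsetP sZ x xZ; rewrite nodesQ !inE => /orP[/eqP xN|//].
      by rewrite -xN xZ in rZ.
  - by apply/forallP=> i; apply/forallP=> j; apply/implyP/disjT.
  - by rewrite {1}eF.
apply/forallP=> Z; apply/implyP=> /imsetP[X]; rewrite inE => /andP[XL sX] ->.
pose QX := induced Q (up X).
have nX' : nodes QX = up X.
  by apply/setIidPr; rewrite nodesQ; apply: subset_trans (subsetUr _ _); rewrite upS.
apply/existsP; exists [ffun i => T i :&: arcs QX]; apply/and3P; split.
- apply/forallP=> i; rewrite ffunE.
  (* An empty member of [L] is not excluded; the empty arc set is an arborescence of the empty
     digraph. *)
  have [X0|nX] := eqVneq X set0.
    have -> : T i :&: arcs QX = set0.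
      apply/setP=> a; rewrite !inE X0 (_ : up set0 = set0) ?inE ?andbF //.
      by apply/eqP; rewrite up_eq0.
    have nQX : nodes QX = set0 by rewrite nX'; apply/eqP; rewrite up_eq0 X0.
    apply/andP; split; last by apply/forallP=> v; rewrite nQX inE.
    apply/and3P; split; first exact: sub0set.
      by apply/forallP=> v; rewrite nQX inE.
    apply/forallP=> n; apply/forallP=> c; apply/negP=> /and4P[].
    by case: c => -[|d c] // _ /= /andP[]; rewrite inE.
  have /card_gt0P[a] := enter i X sX nX; rewrite in_setI => /andP[aT aX].
  have ua b : b \in T i -> b \in dl X -> b = a.
    move=> bT bX; have /card_le1_eqP := le1 i X XL sX nX; apply; rewrite in_setI ?aT ?bT //.
  have /andP[arb _] : rooted_arborescence (tgt Q a) QX (T i :&: arcs QX); last exact: arb.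
  apply: arborescence_intro.
  + exact: subsetIr.
  + by rewrite nX'; move: aX; rewrite inE => /andP[].
  + move=> v vN; have vQ : v \in nodes Q by move: vN; rewrite inE => /andP[].
    apply: leq_trans (deg i v vQ); apply/subset_leq_card/subsetP=> b.
    by rewrite !inE => /andP[/andP[-> _] ->].
  + move=> b; rewrite in_setI => /andP[bT bX]; apply/eqP=> tb.
    have taN : tgt Q a \in nodes Q.
      by case/andP: (arcs_ends (subsetP sF _ (subsetP (sT i) _ aT))).
    have ba := indeg_le1P (deg i _ taN) bT aT tb erefl.
    by move: bX aX; rewrite ba !inE => /and3P[_ ->].
  + move=> Z' sZ' rZ' nZ'; rewrite nX' in sZ'.
    have sZU : Z' \subset up U by apply: subset_trans sZ' _; rewrite upS.
    have /card_gt0P[b] := enterT i Z' sZU nZ'; rewrite in_setI => /andP[bT].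
    rewrite inE => /andP[sb tb]; apply/card_gt0P; exists b.
    rewrite !inE bT sb tb /= (subsetP sF _ (subsetP (sT i) _ bT)) (subsetP sZ' _ tb) !andbT /=.
    (* An arc entering [Z'] from outside [X] enters [X], so it is [a], whose head is the root and
       not in [Z']. *)
    apply: contraT => sbX; have ba : b = a by apply: ua => //; rewrite inE sbX (subsetP sZ').
    by move: rZ'; rewrite -ba tb.
- apply/forallP=> i; apply/forallP=> j; apply/implyP=> /disjT; rewrite !ffunE.
  by apply: disjointW; apply: subsetIl.
- rewrite {1}eF; apply/eqP/setP=> a; rewrite in_setI; apply/andP/bigcupP.
    by case=> /bigcupP[i _ aT] aX; exists i => //; rewrite ffunE in_setI aT.
  by case=> i _; rewrite ffunE in_setI => /andP[aT ->]; split=> //; apply/bigcupP; exists i.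
Qed.

End Translation.

(** Contraction changes no cut of a subset of [U], and an arc with its head in [U] becomes a loop
    only if it was one. *)
Lemma tight_rootedE (G : digraph (option V) B) U F :
  None \in nodes G -> up U \subset nodes G ->
  (forall v, v \in U -> [set v] \in L) ->
  tight_rooted k L G U F = tk (src G) (tgt G) (arcs G) U F.
Proof.
move=> NG sU singL.
have nodesC : nodes (contract G U) = None |: up U.
  apply/setP=> x; rewrite !inE; apply/imsetP/orP=> [[y yG ->]|[/eqP->|xU]].
  - by rewrite /contract_node; case: ifP => [->|_]; [right|left].
  - by exists None => //; rewrite /contract_node None_up.
  - by exists x; [exact: (subsetP sU)|rewrite /contract_node xU].
have -> : tight_rooted k L G U F =
    tk (contract_src G U) (contract_tgt G U) (contract_arcs G U) U F.
  apply/andP/idP=> [[rF tF]|tF]; first exact: (tight_rooted_tk (Q := contract G U) nodesC rF tF).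
  exact: (tk_tight_rooted (Q := contract G U) nodesC singL tF).
have cU x X : X \subset U -> (contract_node U x \in up X) = (x \in up X).
  move=> sX; rewrite /contract_node; case: ifP => // xU; rewrite None_up.
  by apply/esym; apply: contraFF xU; apply/subsetP; rewrite upS.
have dE X : X \subset U -> delta (contract_src G U) (contract_tgt G U) (up X) =
    delta (src G) (tgt G) (up X).
  by move=> sX; apply/setP=> a; rewrite !inE /contract_src /contract_tgt !cU.
have tE a : (contract_tgt G U a \in up U) = (tgt G a \in up U) by apply: cU.
have stE a : tgt G a \in up U ->
    (contract_src G U a != contract_tgt G U a) = (src G a != tgt G a).
  move=> ta; rewrite /contract_tgt /contract_src /contract_node ta; case: ifP => // sa.
  have -> : None != tgt G a by apply: contraTneq ta => <-; rewrite None_up.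
  by apply/esym; apply: contraFneq sa => ->.
apply/tkP/tkP=> -[sF endF ge le]; split=> //.
- by apply: subset_trans sF _; apply/subsetP=> a; rewrite inE => /andP[].
- by move=> a /endF[]; rewrite tE => ta; rewrite stE.
- by move=> X sX nX; rewrite -dE //; apply: ge.
- by move=> X XL sX nX; rewrite -dE //; apply: le.
- apply/subsetP=> a aF; have [ta sa] := endF a aF.
  by rewrite inE (subsetP sF) // stE.
- by move=> a /endF[ta sa]; rewrite tE stE.
- by move=> X sX nX; rewrite dE //; apply: ge.
- by move=> X XL sX nX; rewrite dE //; apply: le.
Qed.

End Numeric.

(** * Rank-weighted connectivity of a contracted digraph *)

(** The axioms of a matroid rank function; a strict drop [r (Q :\ a) < r Q] says that [a] is a
    coloop of [Q]. *)
Definition rank_fun (B : finType) (r : {set B} -> nat) : Prop :=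
  [/\ r set0 = 0,
      forall Q Q' : {set B}, Q \subset Q' -> r Q <= r Q',
      forall (a : B) (Q : {set B}), r (a |: Q) <= (r Q).+1 &
      forall Q Q' : {set B}, r (Q :&: Q') + r (Q :|: Q') <= r Q + r Q'].

Section RankFunctions.
Variables (B : finType) (r : {set B} -> nat).
Hypothesis rP : rank_fun r.
Implicit Types (a : B) (J Q : {set B}).

Lemma rank_fun_subadd Q J : r (Q :|: J) <= r Q + #|J|.
Proof.
case: rP => _ mono inc _.
have [n] := ubnP #|J|; elim: n J => // n IH J; rewrite ltnS => leJ.
case: (set_0Vmem J) => [->|[a aJ]]; first by rewrite setU0 leq_addr.
have cJ := cardsD1 a J; rewrite aJ in cJ.
have -> : Q :|: J = a |: (Q :|: J :\ a) by rewrite setUCA setD1K.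
have ltJ : #|J :\ a| < n by move: leJ; rewrite cJ.
by move: (inc a (Q :|: J :\ a)) (IH _ ltJ); rewrite cJ; lia.
Qed.

Lemma rank_fun_le_card J : r J <= #|J|.
Proof. by case: rP => r0 _ _ _; have := rank_fun_subadd set0 J; rewrite set0U r0. Qed.

(** Submodularity for [Q] and [Q' :\ a]: a coloop remains one in every restriction that contains
    it. *)
Lemma coloop_sub a Q Q' :
  Q \subset Q' -> a \in Q -> r (Q' :\ a) < r Q' -> r (Q :\ a) < r Q.
Proof.
case: rP => _ _ _ subm sQ aQ.
have := subm Q (Q' :\ a).
have -> : Q :&: (Q' :\ a) = Q :\ a.
  by apply/setP=> x; rewrite !inE; case: (boolP (x \in Q)) => [/(subsetP sQ)->|_];
  rewrite ?andbT ?andbF.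
have -> : Q :|: (Q' :\ a) = Q'.
  apply/setP=> x; rewrite !inE; case: eqP => [->|_] /=.
    by rewrite aQ (subsetP sQ).
  by case: (boolP (x \in Q)) => [/(subsetP sQ)->|_].
lia.
Qed.

Lemma coloops_rank Q J : J \subset Q -> (forall a, a \in J -> r (Q :\ a) < r Q) ->
  r (Q :\: J) + #|J| <= r Q.
Proof.
have [n] := ubnP #|J|; elim: n J => // n IH J; rewrite ltnS => leJ sJ co.
case: (set_0Vmem J) => [->|[a aJ]]; first by rewrite setD0 cards0 addn0.
have cJ := cardsD1 a J; rewrite aJ in cJ.
have aQ : a \in Q :\: (J :\ a) by rewrite !inE eqxx (subsetP sJ).
have := coloop_sub (subsetDl _ _) aQ (co a aJ).
have -> : Q :\: (J :\ a) :\ a = Q :\: J.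
  apply/setP=> x; rewrite !inE; case: (x =P a) => [->|_] //=.
  by rewrite aJ.
have : r (Q :\: (J :\ a)) + #|J :\ a| <= r Q.
  apply: IH => [||b]; first by move: leJ; rewrite cJ.
    exact: subset_trans (subsetDl _ _) sJ.
  by rewrite inE => /andP[_ /co].
rewrite cJ; lia.
Qed.

End RankFunctions.

Section Contracted.
Variables (I B : finType) (hd tl : B -> I) (C : {set I}) (k : nat).
Implicit Types (K F R : {set B}) (X Y : {set I}) (i : I) (rho : I -> {set B} -> nat).

(** [C] is to be the set of contracted parts, and an arc from outside has its [tl] outside [C]. Then
    [cutrank] is [r^oplus] of the arcs of [K] entering [X], split by the part that they enter. *)
Definition cut X i : {set B} := [set a | (hd a == i) && (tl a \notin X)].

Definition cutrank rho K X := \sum_(i in X) rho i (K :&: cut X i).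

Definition kconn rho K :=
  [forall X : {set I}, (X \subset C) && (X != set0) ==> (k <= cutrank rho K X)].

Lemma kconnP rho K :
  reflect (forall X, X \subset C -> X != set0 -> k <= cutrank rho K X) (kconn rho K).
Proof.
apply: (iffP forallP) => [h X sX nX|h X]; first by have := h X; rewrite sX nX.
by apply/implyP=> /andP[]; apply: h.
Qed.

Lemma kconnPn rho K : ~~ kconn rho K ->
  exists X, [/\ X \subset C, X != set0 & cutrank rho K X < k].
Proof.
by rewrite negb_forall => /existsP[X]; rewrite negb_imply -ltnNge => /andP[/andP[]]; exists X.
Qed.

Section FixedRank.
Variable rho : I -> {set B} -> nat.
Hypothesis rhoP : forall i, i \in C -> rank_fun (rho i).
Local Notation f := (cutrank rho).

Let rhoC X i : X \subset C -> i \in X -> rank_fun (rho i).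
Proof. by move=> sX iX; apply/rhoP/(subsetP sX). Qed.

Lemma cutrank_mono K K' X : X \subset C -> K \subset K' -> f K X <= f K' X.
Proof.
move=> sX sK; apply: leq_sum => i iX; case: (rhoC sX iX) => _ mono _ _.
exact/mono/setSI.
Qed.

Lemma kconn_mono K K' : K \subset K' -> kconn rho K -> kconn rho K'.
Proof.
move=> sK /kconnP ok; apply/kconnP=> X sX nX.
exact: leq_trans (ok X sX nX) (cutrank_mono sX sK).
Qed.

Lemma sum_cut K X : \sum_(i in X) #|K :&: cut X i| =
  #|K :&: [set a | (hd a \in X) && (tl a \notin X)]|.
Proof.
rewrite -sum1_card (partition_big hd (mem X)) /=; last by move=> a; rewrite !inE => /and3P[].
apply: eq_bigr => i iX; rewrite sum1_card; apply: eq_card => a; rewrite [RHS]unfold_in /= !inE.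
by case: eqP => [->|]; rewrite ?andbF // iX /= andbT.
Qed.

Lemma cutrankU_le K R X : X \subset C ->
  f (K :|: R) X <= f K X + #|R :&: [set a | (hd a \in X) && (tl a \notin X)]|.
Proof.
move=> sX; rewrite -sum_cut -big_split; apply: leq_sum => i iX.
by rewrite setIUl; apply/rank_fun_subadd/(rhoC sX iX).
Qed.

(** A part in both sets contributes by submodularity of its rank, because its cuts for [X :&: Y] and
    [X :|: Y] are the union and the intersection of its cuts for [X] and [Y]. A part in only one of
    them contributes by monotonicity, since enlarging the set shrinks the cut. *)
Lemma cutrank_submod K X Y : X \subset C -> Y \subset C ->
  f K (X :&: Y) + f K (X :|: Y) <= f K X + f K Y.
Proof.
move=> sX sY; rewrite /cutrank.
have E (Z : {set I}) (g : I -> nat) : \sum_(i in Z) g i = \sum_i (i \in Z) * g i.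
  rewrite big_mkcond; apply: eq_bigr => i _; by case: (i \in Z); rewrite ?mul1n ?mul0n.
rewrite !E -!big_split; apply: leq_sum => i _ /=; rewrite !inE.
have mono (Z Z' : {set I}) : i \in C -> Z' \subset Z ->
    rho i (K :&: cut Z i) <= rho i (K :&: cut Z' i).
  move=> iC sZ; case: (rhoP iC) => _ mn _ _; apply/mn/setIS/subsetP => a.
  by rewrite !inE => /andP[->]; apply: contra => /(subsetP sZ).
case: (boolP (i \in X)) => iX; case: (boolP (i \in Y)) => iY; rewrite /= ?mul0n ?mul1n ?addn0 //.
- case: (rhoC sX iX) => _ _ _ /(_ (K :&: cut X i) (K :&: cut Y i)).
  have -> : K :&: cut X i :&: (K :&: cut Y i) = K :&: cut (X :|: Y) i.
    by apply/setP=> a; rewrite !inE; case: (a \in K); case: (hd a == i); case: (tl a \in X).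
  have -> : K :&: cut X i :|: (K :&: cut Y i) = K :&: cut (X :&: Y) i.
    by apply/setP=> a; rewrite !inE; case: (a \in K); case: (hd a == i); case: (tl a \in X).
  by rewrite addnC.
- by rewrite add0n; apply: mono (subsetUl _ _); apply: subsetP iX.
- by rewrite add0n; apply: mono (subsetUr _ _); apply: subsetP iY.
Qed.

Lemma cutrank_del K X e : ~~ ((hd e \in X) && (tl e \notin X)) -> f (K :\ e) X = f K X.
Proof.
move=> ne; apply: eq_bigr => i iX; congr rho.
apply/setP=> a; rewrite !inE; case: eqP => [->|] //=.
by move: ne; case: eqP => [->|]; rewrite ?iX ?andbF //= => /negPf->; rewrite andbF.
Qed.

Lemma cutrank_del_coloop K X e : X \subset C -> f (K :\ e) X < f K X ->
  [/\ hd e \in X, tl e \notin X &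
    rho (hd e) ((K :&: cut X (hd e)) :\ e) < rho (hd e) (K :&: cut X (hd e))].
Proof.
move=> sX lt.
have /andP[hX tX] : (hd e \in X) && (tl e \notin X).
  by apply: contraLR lt => /cutrank_del ->; rewrite ltnn.
split=> //; move: lt.
rewrite /cutrank (bigD1 (hd e)) //= [X in _ < X](bigD1 (hd e)) //=.
have -> : \sum_(i in X | i != hd e) rho i ((K :\ e) :&: cut X i) =
          \sum_(i in X | i != hd e) rho i (K :&: cut X i).
  apply: eq_bigr => i /andP[_ ni]; congr rho; apply/setP=> a; rewrite !inE.
  by case: (a =P e) => [->|] //=; rewrite eq_sym (negPf ni) andbF.
by rewrite ltn_add2r setIDAC.
Qed.

(* Every dispensable root arc is deleted; then each remaining one is a coloop of
   the arcs entering some tight set, hence of those entering the maximal tight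
   set above it, and maximal tight sets are disjoint. *)
Lemma min_root_arcs K R : (forall a, a \in R -> tl a \notin C) ->
  kconn rho (K :|: R) ->
  exists J : {set B}, [/\ J \subset R, kconn rho (K :|: J) &
    exists P : {set {set I}}, [/\ trivIset P, set0 \notin P, cover P \subset C &
      #|J| + \sum_(X in P) f K X <= k * #|P|]].
Proof.
move=> rootR okR.
have [J] := @minset_exists _ (fun J => kconn rho (K :|: J)) R okR.
move=> /minsetP[okJ minJ] sJR; exists J; split=> //.
pose tight X := [&& X \subset C, X != set0 & f (K :|: J) X == k].
pose P := [set X | maxset tight X].
have tP X : X \in P -> tight X by rewrite inE => /maxsetp.
have tightU X Y : tight X -> tight Y -> X :&: Y != set0 -> tight (X :|: Y).
  move=> /and3P[sX nX /eqP eX] /and3P[sY nY /eqP eY] nXY.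
  have := cutrank_submod (K :|: J) sX sY; rewrite eX eY.
  have := kconnP _ _ okJ _ (subset_trans (subsetIl _ _) sX) nXY.
  have sU : X :|: Y \subset C by rewrite subUset sX.
  have nU : X :|: Y != set0.
    by apply: contra nX => /eqP e; rewrite -subset0 -e subsetUl.
  have := kconnP _ _ okJ _ sU nU; rewrite /tight sU nU /= => ge1 ge2 le.
  by rewrite eqn_leq ge1 andbT -(leq_add2l k) (leq_trans _ le) // leq_add2r.
have trivP : trivIset P.
  apply/trivIsetP=> X Y XP YP; apply: contraR; rewrite -setI_eq0 => nXY.
  have tU := tightU X Y (tP X XP) (tP Y YP) nXY.
  move: XP YP; rewrite !inE => /maxsetP[_ mX] /maxsetP[_ mY].
  by rewrite -(mX _ tU (subsetUl _ _)) -{2}(mY _ tU (subsetUr _ _)).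
have nP : set0 \notin P by apply/negP => /tP/and3P[]; rewrite eqxx.
exists P; split=> //.
  by apply/bigcupsP=> X /tP/and3P[].
have tight_coloop e : e \in J -> exists2 X, X \in P & hd e \in X /\
    rho (hd e) (((K :|: J) :&: cut X (hd e)) :\ e) <
      rho (hd e) ((K :|: J) :&: cut X (hd e)).
  move=> eJ; have /kconnPn[X [sX nX lt]] : ~~ kconn rho ((K :|: J) :\ e).
    apply/negP=> ok; have : kconn rho (K :|: J :\ e).
      apply: kconn_mono ok; apply/subsetP=> a; rewrite !inE => /andP[-> /orP[->|->]] //.
      by rewrite orbT.
    by move/minJ/(_ (subsetDl _ _)) => eqJ; move: eJ; rewrite -eqJ !inE eqxx.
  have ge := kconnP _ _ okJ _ sX nX.
  have [hX tX co] := cutrank_del_coloop sX (leq_trans lt ge).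
  have tX' : tight X.
    rewrite /tight sX nX eqn_leq ge andbT /=.
    have := cutrankU_le ((K :|: J) :\ e) [set e] sX.
    have : #|[set e] :&: [set a | (hd a \in X) && (tl a \notin X)]| <= 1.
      by rewrite -(cards1 e) subset_leq_card ?subsetIl.
    have : f (K :|: J) X <= f ((K :|: J) :\ e :|: [set e]) X.
      apply: cutrank_mono => //; apply/subsetP=> a aKJ; move: aKJ; rewrite !inE.
      by move=> ->; rewrite andbT orNb.
    move: lt; clear; lia.
  have [Y mY sXY] := maxset_exists tX'.
  have YP : Y \in P by rewrite inE.
  exists Y => //; split; first exact: (subsetP sXY).
  have sY : Y \subset C by case/and3P: (tP _ YP).
  apply: coloop_sub co.
  - exact: rhoC sX hX.
  - apply/setIS/subsetP=> a; rewrite !inE => /andP[->] /=.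
    by apply: contra => /(subsetP sXY).
  - rewrite !inE eJ orbT eqxx /=; apply: contra (rootR e (subsetP sJR _ eJ)).
    exact: (subsetP sY).
(* Root arcs with head in [X] all enter [X], and each is a coloop at its part; deleting them lowers
   the value [k] of the tight set by at least their number. *)
have part X : X \in P -> f K X + #|[set e in J | hd e \in X]| <= k.
  move=> XP; case/and3P: (tP _ XP) => sX _ /eqP <-.
  have -> : #|[set e in J | hd e \in X]| = \sum_(i in X) #|J :&: cut X i|.
    rewrite sum_cut; apply: eq_card => e; rewrite !inE.
    case: (boolP (e \in J)) => //= eJ; case: (hd e \in X) => //=.
    by apply/esym; apply: contra (rootR e (subsetP sJR _ eJ)) => /(subsetP sX).
  rewrite -big_split; apply: leq_sum => i iX /=.
  have rk := rhoC sX iX.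
  have sJ : J :&: cut X i \subset (K :|: J) :&: cut X i by apply/setSI/subsetUr.
  have J_disj : forall e, e \in K -> e \in J -> False.
    move=> e eK eJ; have : kconn rho (K :|: J :\ e).
      apply: kconn_mono okJ; apply/subsetP=> a; rewrite !inE => /orP[->//|aJ].
      by case: (a =P e) => [->|]; rewrite ?eK // aJ orbT.
    by move/minJ/(_ (subsetDl _ _)) => eqJ; move: eJ; rewrite -eqJ !inE eqxx.
  have -> : K :&: cut X i = ((K :|: J) :&: cut X i) :\: (J :&: cut X i).
    apply/setP=> a; rewrite !inE; have := J_disj a.
    by case: (a \in K); case: (a \in J); case: (hd a == i); case: (tl a \in X) => // /(_ isT isT).
  apply: coloops_rank => // e; rewrite !inE => /andP[eJ /andP[/eqP he _]].
  case: (tight_coloop e eJ) => Y YP [heY co].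
  suff -> : X = Y by rewrite -he.
  apply: contraTeq heY => nXY; rewrite he.
  by have := trivIsetP trivP _ _ XP YP nXY => /disjointFr ->.
have -> : #|J| = \sum_(X in P) #|[set e in J | hd e \in X]|.
  rewrite -sum1_card (partition_big (fun e => pblock P (hd e)) (mem P)) /=; last first.
    by move=> e /tight_coloop[X XP [hX _]]; rewrite (def_pblock trivP XP hX).
  apply: eq_bigr => X XP; rewrite sum1_card; apply: eq_card => e; rewrite [LHS]unfold_in /= inE.
  case: (boolP (e \in J)) => //= /tight_coloop[Y YP [hY _]].
  rewrite (def_pblock trivP YP hY); apply/eqP/idP => [<-//|hX].
  by apply: contraTeq hX => /(trivIsetP trivP _ _ YP XP)/disjointFr->.
rewrite -big_split mulnC -sum_nat_const; apply: leq_sum => X XP.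
by rewrite /= addnC part.
Qed.

(** Weak duality to [min_root_arcs]: each member [X] of [P] needs at least [k - f K X] arcs of [J]
    with head in it, and disjoint members share no such arc. *)
Lemma root_arcs_ge K J (P : {set {set I}}) : trivIset P -> set0 \notin P ->
  cover P \subset C -> kconn rho (K :|: J) ->
  k * #|P| <= #|J| + \sum_(X in P) f K X.
Proof.
move=> tP nP sP ok.
rewrite mulnC -sum_nat_const.
have sX X : X \in P -> X \subset C.
  by move=> XP; apply: subset_trans sP; apply: bigcup_sup XP.
pose hset (X : {set I}) := [set a in J | hd a \in X].
apply: (@leq_trans (\sum_(X in P) (#|hset X| + f K X))).
  apply: leq_sum => X XP; have nX : X != set0 by apply: contra nP => /eqP <-.
  apply: leq_trans (kconnP _ _ ok _ (sX X XP) nX) _.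
  apply: leq_trans (cutrankU_le _ _ (sX X XP)) _; rewrite addnC leq_add2r.
  by apply/subset_leq_card/subsetP=> a; rewrite !inE => /and3P[-> ->].
rewrite big_split leq_add2r.
apply: (@leq_trans #|\bigcup_(X in P) hset X|); last first.
  by apply/subset_leq_card/bigcupsP=> X _; apply/subsetP=> a; rewrite inE => /andP[].
rewrite -!sum1_card.
rewrite (eq_bigr (fun X => \sum_(a in B | a \in hset X) 1)); last first.
  by move=> X _; rewrite sum1_card; apply: eq_card => a.
rewrite (exchange_big_dep (mem (\bigcup_(X in P) hset X))) /=; last first.
  by move=> X a XP ha; apply/bigcupP; exists X.
apply: leq_sum => a _; rewrite sum1_card.
apply/card_le1_eqP => X Y /andP[XP haX] /andP[YP haY].
move: haX haY; rewrite !inE => /andP[_ aX] /andP[_ aY].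
apply/esym/eqP; apply: contraTT aX => nXY.
by rewrite (disjointFl (trivIsetP tP _ _ XP YP _) aY) // eq_sym.
Qed.

(** The subpartition belonging to a minimal [J] inside [R] also bounds [R'] from below, so [J] has
    least size even against arcs taken from elsewhere. *)
Lemma root_arcs_exchange K R R' : (forall a, a \in R -> tl a \notin C) ->
  kconn rho (K :|: R) -> kconn rho (K :|: R') ->
  exists J : {set B}, [/\ J \subset R, kconn rho (K :|: J) & #|J| <= #|R'|].
Proof.
move=> rootR okR okR'.
have [J [sJ okJ [P [tP nP sP leJ]]]] := min_root_arcs rootR okR.
exists J; split=> //; rewrite -(leq_add2r (\sum_(X in P) f K X)).
exact: leq_trans leJ (root_arcs_ge tP nP sP okR').
Qed.

(* If [e] is not a coloop of the arcs of [F] entering [i], and [X] is a smallest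
   set violated by [F - e] over all such [e], then another non-coloop [g] has
   its tail in [X]; uncrossing [X] with a set violated by [F - g] yields a
   smaller one. *)
Lemma kconn_independent K : kconn rho K ->
  exists F : {set B}, [/\ F \subset K, kconn rho F &
    forall i, i \in C -> rho i (F :&: cut [set i] i) = #|F :&: cut [set i] i|].
Proof.
move=> okK; have [F] := @minset_exists _ (kconn rho) K okK.
move=> /minsetP[okF minF] sFK; exists F; split=> // i iC.
pose Ei := F :&: cut [set i] i.
pose N := [set e in Ei | rho i (Ei :\ e) == rho i Ei].
have ri := rhoP iC; have [r0 mono _ _] := ri.
have coN e : e \in Ei -> e \notin N -> rho i (Ei :\ e) < rho i Ei.
  by rewrite !inE => -> /= ne; rewrite ltn_neqAle ne mono ?subsetDl.
apply/eqP; rewrite eqn_leq rank_fun_le_card //=.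
have [N0|[e0 e0N]] := set_0Vmem N.
  have := @coloops_rank _ _ ri Ei Ei (subxx _); rewrite setDv r0; apply=> e eE.
  by apply: coN; rewrite // N0 inE.
exfalso.
pose viol e X := [&& X \subset C, X != set0 & f (F :\ e) X < k].
have violE e : e \in F -> exists X, viol e X.
  move=> eF; have /kconnPn[X [sX nX lt]] : ~~ kconn rho (F :\ e).
    apply/negP=> /minF/(_ (subsetDl _ _)) eqF; move: eF.
    by rewrite -eqF !inE eqxx.
  by exists X; rewrite /viol sX nX.
pose bad := fun p : B * {set I} => (p.1 \in N) && viol p.1 p.2.
have NF e : e \in N -> e \in F by rewrite !inE => /andP[/andP[]].
have [X0 vX0] := violE e0 (NF _ e0N).
have bad0 : bad (e0, X0) by rewrite /bad e0N.
case: (@arg_minnP _ (e0, X0) bad (fun p => #|p.2|) bad0) => -[e X] /= /andP[/= eN vX] minX.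
have violP g Y : viol g Y -> [/\ Y \subset C, Y != set0, hd g \in Y, tl g \notin Y &
    rho (hd g) ((F :&: cut Y (hd g)) :\ g) < rho (hd g) (F :&: cut Y (hd g))].
  case/and3P=> sY nY lt.
  have [] := cutrank_del_coloop sY (leq_trans lt (kconnP _ _ okF _ sY nY)).
  by split.
have hN g : g \in N -> hd g = i by rewrite !inE => /andP[/andP[_ /andP[/eqP]]].
have [sX nX hX tX coX] := violP e X vX; rewrite (hN e eN) in hX coX.
have sPE : F :&: cut X i \subset Ei.
  apply/setIS/subsetP=> a; rewrite !inE => /andP[->]; apply: contra => /eqP ->.
  exact: hX.
(* Otherwise every arc of [Ei] outside the cut of [X] is a coloop of [Ei], so the rank of [Ei] is at
   least that of the cut plus the number of these arcs; as [e] is a coloop of the cut, deleting [e]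
   would lower the rank of [Ei]. *)
have /subsetPn[g gN gX] : ~~ (N \subset F :&: cut X i).
  apply/negP=> sN; move: eN; rewrite inE => /andP[eE /eqP re].
  have := @coloops_rank _ _ ri Ei (Ei :\: (F :&: cut X i)) (subsetDl _ _).
  rewrite setDDr setDv set0U (setIidPr sPE) => co.
  have {}co : rho i (F :&: cut X i) + #|Ei :\: (F :&: cut X i)| <= rho i Ei.
    apply: co => a; rewrite inE => /andP[na aE]; apply: coN => //.
    by apply: contra na => /(subsetP sN).
  have := rank_fun_subadd ri ((F :&: cut X i) :\ e) (Ei :\: (F :&: cut X i)).
  have : rho i (Ei :\ e) <= rho i ((F :&: cut X i) :\ e :|: Ei :\: (F :&: cut X i)).
    apply: mono; apply/subsetP=> a; rewrite !in_setU !in_setD !in_set1.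
    by move=> /andP[-> ->]; case: (a \in _).
  rewrite re; move: co coX; clear; lia.
have gi := hN g gN.
have tgX : tl g \in X.
  by apply: contraR gX => tg; rewrite !inE (NF _ gN) gi eqxx.
have [Y vY] := violE g (NF _ gN).
have [sY nY hY tY _] := violP g Y vY; rewrite gi in hY.
have nXY : X :&: Y != set0 by apply/set0Pn; exists i; rewrite inE hX.
(* The tail of [g] lies in [X], so deleting [g] affects neither [X] nor [X :|: Y]. In [F] the former
   has value at most [k] and the latter at least [k], so the violation at [Y] passes to the
   intersection. *)
have vXY : viol g (X :&: Y).
  apply/and3P; split => //; first exact: subset_trans (subsetIl _ _) sX.
  have := cutrank_submod (F :\ g) sX sY.
  rewrite (@cutrank_del _ X) ?tgX ?andbF // (@cutrank_del _ (X :|: Y)) ?inE ?tgX ?andbF //.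
  case/and3P: vY => _ _ ltY.
  have sU : X :|: Y \subset C by rewrite subUset sX.
  have nU : X :|: Y != set0.
    by apply: contra nX => /eqP e'; rewrite -subset0 -e' subsetUl.
  have leX : f F X <= k.
    case/and3P: vX => _ _ ltX; have := cutrankU_le (F :\ e) [set e] sX.
    rewrite setUC setD1K ?NF //; move: ltX.
    have : #|[set e] :&: [set a | (hd a \in X) && (tl a \notin X)]| <= 1.
      by rewrite -(cards1 e) subset_leq_card ?subsetIl.
    by clear; lia.
  move: (kconnP _ _ okF _ sU nU) ltY leX; clear; lia.
have := minX (g, X :&: Y); rewrite /bad /= gN vXY => /(_ isT).
rewrite leqNgt => /negP; apply; apply: proper_card.
rewrite properE subsetIl; apply/subsetPn; exists (tl g) => //.
by rewrite inE tgX.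
Qed.

End FixedRank.
End Contracted.

(** * Bases along a laminar family *)

Lemma subset_of_card (T : finType) (Z : {set T}) n : n <= #|Z| ->
  exists2 Y : {set T}, Y \subset Z & #|Y| = n.
Proof.
elim: n => [|n IH] le; first by exists set0; rewrite ?sub0set ?cards0.
have [Y sY cY] := IH (ltnW le).
have /card_gt0P[x] : 0 < #|Z :\: Y| by rewrite cardsD (setIidPr sY) cY subn_gt0.
rewrite inE => /andP[xY xZ]; exists (x |: Y); first by rewrite subUset sub1set xZ.
by rewrite cardsU1 xY cY.
Qed.

Lemma sum_mem_trivIset (I : finType) (P : {set {set I}}) x : trivIset P ->
  \sum_(X in P) (x \in X) <= 1.
Proof.
move=> tP; have -> : \sum_(X in P) (x \in X) = \sum_(X in P | x \in X) 1.
  by rewrite big_mkcondr; apply: eq_bigr => X _; case: (x \in X).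
rewrite sum1_card; apply/card_le1_eqP => X Y /andP[XP xX] /andP[YP xY].
apply/eqP; apply: contraTT xX => nXY.
by rewrite (disjointFl (trivIsetP tP _ _ XP YP _) xY) // eq_sym.
Qed.

Section LaminarParts.
Variables (V : finType) (L : {set {set V}}) (W : {set V}).
Hypothesis L_laminar : laminar L.
Hypothesis singL : forall v, v \in W -> [set v] \in L.
Hypothesis W_gt1 : 1 < #|W|.
Local Notation C := (max_parts L W).
Implicit Types (U X : {set V}).

Lemma max_parts_exists X : X \in L -> X \subset W -> X != W -> exists2 U, U \in C & X \subset U.
Proof.
move=> XL sX nX; have XW : X \in below L W :\ W by rewrite !inE nX XL.
have [U mU sXU] := @maxset_exists _ (fun Y => Y \in below L W :\ W) X XW.
by exists U => //; rewrite inE.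
Qed.

Lemma max_parts_single v : v \in W -> exists2 U, U \in C & v \in U.
Proof.
move=> vW; have [||U UC] := max_parts_exists (singL vW); last by rewrite sub1set; exists U.
  by rewrite sub1set.
by apply: contraTneq W_gt1 => <-; rewrite cards1.
Qed.

(** A part is nonempty even if [set0] belongs to [L]: some other part contains a node of [W], and
    [set0] lies below it. *)
Lemma max_partsP U : U \in C -> [/\ U \in L, U \subset W, U != W & U != set0].
Proof.
rewrite inE => /maxsetP[]; rewrite !inE => /and3P[nUW UL sU] mU; split=> //.
have /card_gt0P[v vW] : 0 < #|W| by apply: ltnW.
have [U' U'C vU'] := max_parts_single vW.
apply: contraTneq vU' => U0; move: U'C; rewrite inE => /maxsetP[U'B _].
by rewrite (mU U' U'B) U0 ?sub0set // inE.
Qed.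

Lemma max_parts_trivIset : trivIset C.
Proof.
apply/trivIsetP => U U' UC U'C; apply: contraR => nd.
have [UL _ _ _] := max_partsP UC; have [U'L _ _ _] := max_partsP U'C.
move: UC U'C; rewrite !inE => /maxsetP[UB mU] /maxsetP[U'B mU'].
case/or3P: (L_laminar UL U'L) => [d|sU|sU]; first by rewrite d in nd.
  by rewrite (mU _ U'B).
by rewrite (mU' _ UB).
Qed.

Lemma max_parts_set0 : set0 \notin C.
Proof. by apply/negP=> /max_partsP[]; rewrite eqxx. Qed.

Lemma max_parts_cover : cover C = W.
Proof.
apply/eqP; rewrite eqEsubset; apply/andP; split.
  by apply/bigcupsP=> U /max_partsP[].
by apply/subsetP=> v /max_parts_single[U UC vU]; apply/bigcupP; exists U.
Qed.

(** [set0], which is never a part, stands for everything outside [W]: for [None] and, through the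
    default of [pblock], for nodes in no part. *)
Definition part_of (o : option V) : {set V} := if o is Some v then pblock C v else set0.

Lemma part_of_cover (Q : {set {set V}}) o : Q \subset C ->
  (part_of o \in Q) = (o \in up (cover Q)).
Proof.
move=> sQ; have nQ : set0 \notin Q by apply: contra max_parts_set0; apply: (subsetP sQ).
case: o => [v|]; last by rewrite None_up; apply: negbTE.
rewrite mem_up /=; apply/idP/bigcupP => [pQ|[U UQ vU]].
  exists (pblock C v) => //; rewrite mem_pblock.
  have [//|vC] := boolP (v \in cover C); rewrite /pblock in pQ *.
  case: pickP pQ => [U /= /andP[UC vU] _|_ /=]; last by rewrite (negPf nQ).
  by case/bigcupP: vC; exists U.
by rewrite (def_pblock max_parts_trivIset (subsetP sQ _ UQ) vU).
Qed.

Lemma part_of_eq U o : U \in C -> (part_of o == U) = (o \in up U).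
Proof.
by move=> UC; rewrite -[_ == U](in_set1 _ U) part_of_cover ?sub1set // cover1.
Qed.

End LaminarParts.

(** * The matroid of extendable arc sets *)

Section Core.
Variables (V B : finType) (s t : B -> option V) (k : nat) (L : {set {set V}}).
Hypothesis k_gt0 : 0 < k.
Hypothesis L_laminar : laminar L.
Hypothesis singL : forall U v, U \in L -> v \in U -> [set v] \in L.
Implicit Types (E F K Q b : {set B}) (U X W : {set V}) (h : B).
Local Notation In X := (delta s t (up X)).
Local Notation tk := (tk k L s t).

Definition tbase E U b :=
  [&& b \subset E :&: In U, #|b| == k & [exists F : {set B}, tk E U F && (b \subset F)]].

(** The rank computed through bases instead of independent sets; without any base the maximum is
    0. *)
Definition trank E U Q := \max_(b : {set B} | tbase E U b) #|Q :&: b|.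

Lemma trank_ge E U Q b : tbase E U b -> #|Q :&: b| <= trank E U Q.
Proof. by move=> bb; apply: (leq_bigmax_cond (F := fun b => #|Q :&: b|)). Qed.

Lemma trank_base E U Q b : tbase E U b -> exists2 b, tbase E U b & trank E U Q = #|Q :&: b|.
Proof.
move=> bb; have : 0 < #|[set b | tbase E U b]| by apply/card_gt0P; exists b; rewrite inE.
rewrite cardsE => /(eq_bigmax_cond (fun b => #|Q :&: b|))[b' b'b e].
by exists b'.
Qed.

Lemma trankP E U Q : 0 < trank E U Q -> exists2 b, tbase E U b & trank E U Q = #|Q :&: b|.
Proof.
have [b bb _|no] := pickP (tbase E U); first exact: trank_base bb.
by rewrite /trank big_pred0.
Qed.

Lemma tbase_card E U b : tbase E U b -> #|b| = k.
Proof. by case/and3P=> _ /eqP. Qed.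

Lemma tbase_sub E U b : tbase E U b -> b \subset E :&: In U.
Proof. by case/and3P. Qed.

Lemma trank_sub_base E U Q b : tbase E U b -> Q \subset b -> trank E U Q = #|Q|.
Proof.
move=> bb sQ; apply/eqP; rewrite eqn_leq; apply/andP; split.
  by apply/bigmax_leqP=> b' _; apply/subset_leq_card/subsetIl.
by rewrite -{1}(setIidPl sQ); apply: trank_ge.
Qed.

Lemma trank_setI E U Q : trank E U (Q :&: E) = trank E U Q.
Proof.
apply: eq_bigr => b /tbase_sub; rewrite subsetI => /andP[sb _].
by rewrite -setIA (setIidPr sb).
Qed.

Lemma trank_le_card E U Q : trank E U Q <= #|Q|.
Proof. by apply/bigmax_leqP=> b _; apply/subset_leq_card/subsetIl. Qed.

Definition exchange E U := forall b0 b1 K, tbase E U b0 -> tbase E U b1 -> K \subset b0 ->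
  exists2 J : {set B}, J \subset b1 & tbase E U (K :|: J).

(** For submodularity, the trace on [Q :&: Q'] of a base best for that set is completed from a base
    best for [Q :|: Q']. What the result has outside [Q :|: Q'] comes from the second base, so it is
    best for both sets at once. *)
Lemma exchange_rank_fun E U : exchange E U -> rank_fun (trank E U).
Proof.
move=> exch; split.
- by apply/eqP; rewrite -leqn0 -(@cards0 B) trank_le_card.
- move=> Q Q' sQ; apply/bigmax_leqP=> b bb; apply: leq_trans (trank_ge Q' bb).
  exact/subset_leq_card/setSI.
- move=> a Q; apply/bigmax_leqP=> b bb.
  apply: (@leq_trans (#|Q :&: b| + 1)); last by rewrite addn1 ltnS trank_ge.
  rewrite setIUl; apply: leq_trans (leq_card_setU _ _) _; rewrite addnC leq_add2l.
  by rewrite -(cards1 a) subset_leq_card ?subsetIl.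
- move=> Q Q'; have [b bb|no] := pickP (tbase E U); last by rewrite /trank !big_pred0.
  have [b0 b0b ->] := trank_base (Q :&: Q') bb.
  have [b1 b1b e1] := trank_base (Q :|: Q') bb; rewrite e1.
  have [J sJ bJ] := exch b0 b1 (Q :&: Q' :&: b0) b0b b1b (subsetIr _ _).
  set b2 := _ :|: J in bJ.
  apply: leq_trans (leq_add (trank_ge Q bJ) (trank_ge Q' bJ)).
  rewrite -[leqRHS]cardsUI addnC -setIUl -setIIl; apply: leq_add.
    rewrite -(leq_add2r #|b1 :\: (Q :|: Q')|) setIC cardsID (tbase_card b1b) -(tbase_card bJ).
    rewrite -(cardsID (Q :|: Q') b2) setIC leq_add2l; apply/subset_leq_card/subsetP=> a.
    by rewrite !inE => /andP[/norP[/negPf-> /negPf->]] /= aJ; rewrite (subsetP sJ).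
  apply/subset_leq_card/subsetP=> a aa; rewrite in_setI; apply/andP; split.
    by move: aa; rewrite inE => /andP[].
  by rewrite inE aa.
Qed.

Lemma tk_base E W U F : tk E W F -> U \in L -> U \subset W -> U != set0 ->
  tbase E U (F :&: In U).
Proof.
case/tkP=> sF endF ge le UL sU nU.
have sub X : X \subset U -> X \subset W by move/subset_trans; apply.
have eX X : X \subset U -> F :&: [set a | t a \in up U] :&: In X = F :&: In X.
  move=> sX; apply/setP=> a; rewrite !inE -upS in sX *.
  by case: (boolP (t a \in up X)) => [/(subsetP sX)->|_]; rewrite ?andbT ?andbF.
apply/and3P; split.
- exact: setSI.
- by rewrite eqn_leq le ?ge.
- apply/existsP; exists (F :&: [set a | t a \in up U]); apply/andP; split.
    apply/tkP; split.
    + exact: subset_trans (subsetIl _ _) sF.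
    + by move=> a; rewrite !inE => /andP[/endF[_ ->] ->].
    + by move=> X sX nX; rewrite eX //; apply: ge => //; apply: sub.
    + by move=> X XL sX nX; rewrite eX //; apply: le => //; apply: sub.
  by apply/subsetP=> a; rewrite !inE => /and3P[-> _ ->].
Qed.

Lemma tbase_ext E U b : tbase E U b -> U \in L -> U != set0 ->
  exists2 F, tk E U F & b = F :&: In U.
Proof.
case/and3P=> sb /eqP cb /existsP[F /andP[tF sbF]] UL nU; exists F => //.
apply/eqP; rewrite eqEcard subsetI sbF (subset_trans sb (subsetIr _ _)) cb /=.
by case/tkP: tF => _ _ _ ->.
Qed.

(** If [h] lies inside [U], the bases for [E] and for [h |: E] live on the same ground set, so this
    is not matroid deletion. The base [b0] only witnesses that [E] is feasible. *)
Definition arc_swap E U := forall h b0 b, tbase E U b0 -> tbase (h |: E) U b ->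
  exists2 b', tbase E U b' & #|b :\: b'| <= 1.

Lemma tbase_add_arc E U h b : U \in L -> U != set0 -> t h \notin up U ->
  tbase (h |: E) U b -> tbase E U b.
Proof.
move=> UL nU th bb; have [F tF ->] := tbase_ext bb UL nU.
apply: (tk_base _ UL (subxx _) nU); case/tkP: tF => sF endF ge le; apply/tkP; split=> //.
apply/subsetP=> a aF; move: (subsetP sF a aF); rewrite !inE => /orP[/eqP ah|//].
by have [ta _] := endF a aF; rewrite ah (negPf th) in ta.
Qed.

Lemma trank_add_arc E U h Q b0 : U \in L -> U != set0 -> arc_swap E U -> tbase E U b0 ->
  trank (h |: E) U Q <= trank E U Q + (t h \in up U).
Proof.
move=> UL nU swap bb0; apply/bigmax_leqP=> b bb.
have [th|th] := boolP (t h \in up U); last first.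
  by rewrite addn0; apply/trank_ge/tbase_add_arc/bb.
have [b' bb' le1] := swap h b0 b bb0 bb.
apply: leq_trans (leq_add (trank_ge Q bb') le1).
apply: leq_trans (leq_card_setU _ _); apply/subset_leq_card/subsetP=> a.
by rewrite !inE => /andP[-> ->]; rewrite andbT orbN.
Qed.

Section Step.
Variable W : {set V}.
Hypothesis WL : W \in L.
Hypothesis W_gt1 : 1 < #|W|.
Local Notation C := (max_parts L W).
Local Notation hd := (fun a => part_of L W (t a)).
Local Notation tl := (fun a => part_of L W (s a)).
(** All arcs inside [W], in [E] or not: [trank E] ignores arcs outside [E], so the same set serves
    for [E] and [h |: E]. *)
Local Notation inner := [set a | (s a \in up W) && (t a \in up W)].
Local Notation kc E := (kconn hd tl C k (trank E)).

Let sing v : v \in W -> [set v] \in L. Proof. exact: singL. Qed.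
Let partsP := max_partsP sing W_gt1.
Let coverC := max_parts_cover sing W_gt1.
Let W_neq0 : W != set0. Proof. by rewrite -card_gt0 ltnW. Qed.

Let pcover (Q : {set {set V}}) o : Q \subset C -> (part_of L W o \in Q) = (o \in up (cover Q)).
Proof. exact: part_of_cover. Qed.

Lemma part_entering (Q : {set {set V}}) : Q \subset C ->
  [set a | (hd a \in Q) && (tl a \notin Q)] = In (cover Q).
Proof. by move=> sQ; apply/setP=> a; rewrite !inE !pcover // andbC. Qed.

Lemma cut_part (Q : {set {set V}}) U : Q \subset C -> U \in Q ->
  cut hd tl Q U = [set a | (t a \in up U) && (s a \notin up (cover Q))].
Proof.
move=> sQ UQ; apply/setP=> a; rewrite !inE pcover //.
by rewrite (part_of_eq L_laminar sing W_gt1) // (subsetP sQ).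
Qed.

Lemma cut_part_sub (Q : {set {set V}}) U : Q \subset C -> U \in Q -> cut hd tl Q U \subset In U.
Proof.
move=> sQ UQ; rewrite cut_part //; apply/subsetP=> a; rewrite !inE => /andP[-> sa].
rewrite andbT; apply: contra sa; apply: subsetP; rewrite upS; exact: bigcup_sup UQ.
Qed.

Lemma cut1_part U : U \in C -> cut hd tl [set U] U = In U.
Proof.
move=> UC; rewrite cut_part ?sub1set ?set11 // cover1.
by apply/setP=> a; rewrite !inE andbC.
Qed.

Lemma root_entering a : a \in In W -> tl a \notin C.
Proof. by rewrite inE pcover // coverC => /andP[]. Qed.

Lemma cutrank_le_card E K (Q : {set {set V}}) : Q \subset C ->
  cutrank hd tl (trank E) K Q <= #|K :&: In (cover Q)|.
Proof.
move=> sQ; rewrite -part_entering // -(@sum_cut _ _ hd tl).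
by apply: leq_sum => U _; apply: trank_le_card.
Qed.

Lemma kconn_entering E K : kc E K -> k <= #|K :&: In W|.
Proof.
move/kconnP/(_ C (subxx _)) => h; rewrite -coverC.
apply: leq_trans (cutrank_le_card E K (subxx _)); apply: h.
by apply: contra W_neq0 => /eqP C0; rewrite -coverC C0 /cover big_set0.
Qed.

(** The arcs of [F] entering a part form a base there, so rank is cardinality on their subsets. *)
Lemma tk_kconn E F : tk E W F -> kc E F.
Proof.
move=> tF; apply/kconnP=> Q sQ nQ.
have -> : cutrank hd tl (trank E) F Q = #|F :&: In (cover Q)|.
  rewrite -part_entering // -(@sum_cut _ _ hd tl); apply: eq_bigr => U UQ.
  have [UL sU _ nU] := partsP (subsetP sQ _ UQ).
  apply: trank_sub_base (tk_base tF UL sU nU) _.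
  by apply/setIS/cut_part_sub.
case/tkP: tF => _ _ ge _; apply: ge.
  by rewrite -coverC; apply/bigcupsP=> U UQ; apply: bigcup_sup (subsetP sQ _ UQ).
case/set0Pn: nQ => U UQ; have [_ _ _ /set0Pn[v vU]] := partsP (subsetP sQ _ UQ).
by apply/set0Pn; exists v; apply/bigcupP; exists U.
Qed.

Section Glue.
Variable E : {set B}.
Hypothesis rankE : forall U, U \in C -> rank_fun (trank E U).

Lemma base_kconn b : tbase E W b -> kc E (inner :|: b).
Proof.
move=> bb; have [F tF eb] := tbase_ext bb WL W_neq0.
apply: (kconn_mono rankE) (tk_kconn tF); case/tkP: tF => _ endF _ _.
apply/subsetP=> a aF; rewrite eb !inE aF; have [-> _] := endF a aF.
by case: (s a \in up W).
Qed.

(* Gluing: the arcs of an inclusionwise minimal [k]-connected subset entering a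
   part form a base there, hence extend to an arborescence packing inside it. *)
Lemma kconn_base b : b \subset E :&: In W -> #|b| <= k -> kc E (inner :|: b) ->
  tbase E W b.
Proof.
move=> sb leb ok; have [Fc [sFc okFc indep]] := kconn_independent rankE ok.
(* The arcs of [Fc] entering [U] are independent and have rank at least [k], the size of a base. *)
have baseFc U : U \in C -> tbase E U (Fc :&: In U).
  move=> UC; have := indep U UC; rewrite cut1_part // => eU.
  have := kconnP _ _ _ _ _ _ okFc [set U]; rewrite sub1set UC => /(_ isT).
  rewrite /cutrank big_set1 cut1_part // eU => h.
  have {}h : k <= #|Fc :&: In U| by apply: h; apply/set0Pn; exists U; rewrite inE.
  have [b' b'b e'] : exists2 b', tbase E U b' &
      trank E U (Fc :&: In U) = #|Fc :&: In U :&: b'|.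
    by apply: trankP; rewrite eU (leq_trans k_gt0).
  rewrite eU in e'.
  suff -> : Fc :&: In U = b' by [].
  have sF : Fc :&: In U \subset b'.
    by apply/setIidPl/eqP; rewrite eqEcard subsetIl -e' leqnn.
  by apply/eqP; rewrite eqEcard sF (tbase_card b'b).
have FcW : Fc :&: In W = b.
  apply/eqP; rewrite eqEcard (leq_trans leb (kconn_entering okFc)) andbT.
  apply/subsetP=> a; rewrite !inE => /and3P[/(subsetP sFc)]; rewrite !inE => h sa _.
  by move: h; rewrite (negPf sa).
pose f U := odflt set0 [pick F : {set B} | tk E U F && (F :&: In U == Fc :&: In U)].
have fP U : U \in C -> tk E U (f U) /\ f U :&: In U = Fc :&: In U.
  move=> UC; have [UL _ _ nU] := partsP UC; rewrite /f.
  case: pickP => [F /andP[tF /eqP //]|no].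
  have [F tF e] := tbase_ext (baseFc U UC) UL nU.
  by have := no F; rewrite tF e eqxx.
pose F := \bigcup_(U in C) f U.
have fU U a : U \in C -> a \in f U -> t a \in up U.
  by move=> /fP[/tkP[_ endF _ _] _] /endF[].
have FX U X : U \in C -> X \subset U -> F :&: In X = f U :&: In X.
  move=> UC sX; apply/setP=> a; rewrite !inE; apply: andb_id2r => /andP[_ taX].
  apply/bigcupP/idP => [[U' U'C aU']|aU]; last by exists U.
  suff -> : U = U' by [].
  have /eqP <- : part_of L W (t a) == U.
    by rewrite (part_of_eq L_laminar sing W_gt1) //; apply: subsetP taX; rewrite upS.
  by apply/eqP; rewrite (part_of_eq L_laminar sing W_gt1) // (fU U').
have FQ (Q : {set {set V}}) : Q \subset C -> Q != set0 -> k <= #|F :&: In (cover Q)|.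
  move=> sQ nQ; apply: leq_trans (kconnP _ _ _ _ _ _ okFc Q sQ nQ) _.
  apply: leq_trans (cutrank_le_card E Fc sQ) _; apply/subset_leq_card/subsetP=> a.
  rewrite in_setI => /andP[aF aQ]; rewrite in_setI aQ andbT.
  move: aQ; rewrite inE -!(pcover _ sQ) => /andP[sa taQ].
  have UC := subsetP sQ _ taQ; apply/bigcupP; exists (hd a) => //.
  have [_ e] := fP _ UC; have : a \in Fc :&: In (hd a).
    rewrite in_setI aF inE -(part_of_eq L_laminar sing W_gt1 (t a) UC) eqxx andbT.
    rewrite (pcover _ sQ) in sa; apply: contra sa; apply: subsetP.
    by rewrite upS; apply: bigcup_sup taQ.
  by rewrite -e inE => /andP[].
have FW : F :&: In W = b.
  rewrite -FcW; apply/setP=> a; rewrite !in_setI; apply: andb_id2r.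
  move=> aW; move: (aW); rewrite inE => /andP[sa ta].
  have UC : hd a \in C by rewrite pcover // coverC.
  have [_ sU _ _] := partsP UC; have [_ e] := fP _ UC.
  have aU : a \in In (hd a).
    rewrite inE -(part_of_eq L_laminar sing W_gt1 (t a) UC) eqxx andbT.
    by apply: contra sa; apply: subsetP; rewrite upS.
  have : (a \in f (hd a)) = (a \in Fc).
    by move/setP: e => /(_ a); rewrite !in_setI aU !andbT.
  have : (a \in F) = (a \in f (hd a)).
    by have /setP/(_ a) := FX _ _ UC (subxx _); rewrite !in_setI aU !andbT.
  by move=> -> ->.
have tF : tk E W F.
  apply/tkP; split.
  - by apply/bigcupsP=> U /fP[/tkP[]].
  - move=> a /bigcupP[U UC aU]; have [_ sU _ _] := partsP UC.
    have [/tkP[_ endF _ _] _] := fP U UC; have [ta ->] := endF a aU; split=> //.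
    by apply: (subsetP _ _ ta); rewrite upS.
  (* Adding to [X] a part [U] that it meets does not increase the number of entering arcs: at most
     [k] arcs enter [U] and at least [k] enter the intersection. In the end the set is a union of
     parts, covered by [FQ]. *)
  - move=> X sX nX; pose Q := [set U in C | X :&: U != set0].
    have sQ : Q \subset C by apply/subsetP=> U; rewrite inE => /andP[].
    have sXQ : X \subset cover Q.
      apply/subsetP=> v vX; have [U UC vU] := max_parts_single sing W_gt1 (subsetP sX _ vX).
      by apply/bigcupP; exists U => //; rewrite inE UC; apply/set0Pn; exists v; rewrite inE vX.
    have nQ : Q != set0.
      apply: contra nX => /eqP Q0; move: sXQ; rewrite Q0 /cover big_set0 subset0 //.
    apply: leq_trans (FQ Q sQ nQ) _.
    suff step l : {subset l <= Q} ->
        #|F :&: In (X :|: \bigcup_(U <- l) U)| <= #|F :&: In X|.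
      have := step (enum Q); rewrite big_enum /=.
      have -> : X :|: \bigcup_(U in Q) U = cover Q by apply/setUidPr.
      by apply=> U; rewrite mem_enum.
    elim: l => [|U l IH] lQ; first by rewrite big_nil setU0.
    have UQ : U \in Q by apply: lQ; rewrite inE eqxx.
    have {}IH : #|F :&: In (X :|: \bigcup_(U <- l) U)| <= #|F :&: In X|.
      by apply: IH => U' U'l; apply: lQ; rewrite inE U'l orbT.
    apply: leq_trans IH; rewrite big_cons setUCA; set Y := X :|: _.
    have UC := subsetP sQ _ UQ; have [UL sU _ nU] := partsP UC.
    have [/tkP[_ _ geU leU] _] := fP U UC.
    have nYU : Y :&: U != set0.
      move: UQ; rewrite inE => /andP[_ /set0Pn[v]]; rewrite inE => /andP[vX vU].
      by apply/set0Pn; exists v; rewrite !inE vX vU.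
    have := delta_submod s t F (up Y) (up U).
    rewrite -upI -upU (FX U) ?subsetIr // (FX U U) //.
    have := geU _ (subsetIr Y U) nYU; have := leU U UL (subxx _) nU.
    rewrite [U :|: Y]setUC => le1 ge1 le2.
    rewrite -(leq_add2l k) (leq_trans _ (leq_trans le2 _)) ?leq_add2r //.
    by rewrite addnC leq_add2r.
  - move=> X XL sX nX; have [->|nXW] := eqVneq X W; first by rewrite FW.
    have [U UC sXU] := max_parts_exists XL sX nXW; rewrite (FX U) //.
    by have [/tkP[_ _ _ le] _] := fP U UC; apply: le.
apply/and3P; split=> //.
  rewrite eqn_leq leb -FcW; exact: kconn_entering okFc.
by apply/existsP; exists F; rewrite tF -FW subsetIl.
Qed.

(** Since [b0 :\: K] completes [K], by [root_arcs_exchange] equally few arcs chosen from [b1] do so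
    too. *)
Lemma exchange_step : exchange E W.
Proof.
move=> b0 b1 K bb0 bb1 sK.
have ok1 : kc E ((inner :|: K) :|: b1).
  by apply: (kconn_mono rankE) (base_kconn bb1); rewrite setUAC subsetUl.
have ok0 : kc E ((inner :|: K) :|: (b0 :\: K)).
  have -> : inner :|: K :|: b0 :\: K = inner :|: b0; last exact: base_kconn.
  apply/setP=> a; rewrite !in_setU in_setD.
  by case: (boolP (a \in K)) => [/(subsetP sK)->|_]; rewrite ?orbT ?orbF.
have root1 a : a \in b1 -> tl a \notin C.
  by move/(subsetP (tbase_sub bb1)); rewrite in_setI => /andP[_ /root_entering].
have [J [sJ okJ cJ]] := root_arcs_exchange rankE root1 ok1 ok0.
exists J => //; apply: kconn_base.
- by rewrite subUset (subset_trans sK (tbase_sub bb0)) (subset_trans sJ (tbase_sub bb1)).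
- apply: leq_trans (leq_card_setU _ _) _.
  by rewrite -(tbase_card bb0) -(cardsID K b0) (setIidPr sK) leq_add2l.
- by rewrite setUA.
Qed.

End Glue.

Lemma kconn_setI E K : kc E K -> kc E (K :&: E).
Proof.
move/kconnP=> ok; apply/kconnP=> Q sQ nQ; apply: leq_trans (ok Q sQ nQ) _.
by apply: leq_sum => U _; rewrite setIAC trank_setI.
Qed.

Lemma cutrank_add_arc E h K (Q : {set {set V}}) : Q \subset C ->
  (forall U Z, U \in C -> trank (h |: E) U Z <= trank E U Z + (t h \in up U)) ->
  cutrank hd tl (trank (h |: E)) K Q <= cutrank hd tl (trank E) K Q + (hd h \in Q).
Proof.
move=> sQ le; apply: (@leq_trans (\sum_(U in Q)
    (trank E U (K :&: cut hd tl Q U) + (hd h == U)))).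
  apply: leq_sum => U UQ; have UC := subsetP sQ _ UQ.
  by rewrite (part_of_eq L_laminar sing W_gt1 _ UC) le.
rewrite big_split leq_add2l /=; have [hQ|hQ] := boolP (hd h \in Q).
  rewrite (bigD1 _ hQ) /= eqxx big1 // => U /andP[_ nU].
  by rewrite eq_sym (negPf nU).
by rewrite big1 // => U UQ; case: eqP hQ => // ->; rewrite UQ.
Qed.

(** By the min-max formula [b] lacks at most one root arc for [E]: the ranks fall short by at most
    one, only at the part of the head of [h], which lies in at most one member of [P]. With that arc
    added, a base is chosen inside. *)
Lemma arc_swap_step E h b0 b : tbase E W b0 ->
  (forall U, U \in C -> rank_fun (trank E U)) ->
  (forall U, U \in C -> rank_fun (trank (h |: E) U)) ->
  (forall U Z, U \in C -> trank (h |: E) U Z <= trank E U Z + (t h \in up U)) ->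
  tbase (h |: E) W b -> exists2 b', tbase E W b' & #|b :\: b'| <= 1.
Proof.
move=> bb0 rankE rankE' le bb.
have rootb E' b' a : tbase E' W b' -> a \in b' -> tl a \notin C.
  by move=> bb' /(subsetP (tbase_sub bb')); rewrite in_setI => /andP[_ /root_entering].
have ok1 : kc E ((inner :|: b) :|: b0).
  by apply: (kconn_mono rankE) (base_kconn rankE bb0); rewrite setUAC subsetUl.
have [J [sJ okJ [P [tP nP sP leJ]]]] := min_root_arcs rankE (rootb E b0 ^~ bb0) ok1.
have J1 : #|J| <= 1.
  rewrite -(leq_add2r (\sum_(X in P) cutrank hd tl (trank E) (inner :|: b) X)).
  apply: leq_trans leJ _; rewrite mulnC -sum_nat_const.
  apply: (@leq_trans (\sum_(X in P)
    (cutrank hd tl (trank E) (inner :|: b) X + (hd h \in X)))).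
    apply: leq_sum => X XP.
    have sX : X \subset C by apply: subset_trans sP; apply: bigcup_sup XP.
    have nX : X != set0 by apply: contraNneq nP => <-.
    apply: leq_trans (cutrank_add_arc _ sX le).
    exact: (kconnP _ _ _ _ _ _ (base_kconn rankE' bb)).
  by rewrite big_split /= addnC leq_add2r sum_mem_trivIset.
have root' a : a \in (b :&: E) :|: J -> tl a \notin C.
  rewrite in_setU in_setI => /orP[/andP[ab _]|/(subsetP sJ)]; last exact: (rootb _ _ _ bb0).
  exact: (rootb _ _ _ bb ab).
have ok' : kc E (inner :|: ((b :&: E) :|: J)).
  apply: (kconn_mono rankE) (kconn_setI okJ); apply/subsetP=> a.
  by rewrite !in_setI !in_setU !in_setI; case: (a \in E); rewrite ?andbF ?andbT // orbA.
have [J' [sJ' okJ' cJ']] := root_arcs_exchange rankE root' ok' (base_kconn rankE bb0).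
have bJ' : tbase E W J'.
  apply: kconn_base => //; last by rewrite -(tbase_card bb0).
  apply: subset_trans sJ' _; rewrite subUset (subset_trans sJ (tbase_sub bb0)) andbT.
  rewrite setIC; apply/setIS/(subset_trans (tbase_sub bb)).
  exact: subsetIr.
exists J' => //.
(* Bases have equal size, so [b] loses as many arcs as it gains, and all gained arcs are in [J]. *)
have -> : #|b :\: J'| = #|J' :\: b|.
  apply: (@addnI #|b :&: J'|); rewrite cardsID setIC cardsID.
  by rewrite (tbase_card bb) (tbase_card bJ').
apply: leq_trans J1; apply/subset_leq_card/subsetP=> a.
rewrite inE => /andP[ab /(subsetP sJ')]; rewrite !inE => /orP[/andP[]|//].
by rewrite (negPf ab).
Qed.

End Step.

(** The base of the induction: at a single node the matroid is uniform. *)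
Lemma single_tbase E v b : [set v] \in L ->
  tbase E [set v] b = (b \subset E :&: In [set v]) && (#|b| == k).
Proof.
move=> vL; apply/and3P/andP=> [[]//|[sb cb]]; split=> //.
have eX X : X \subset [set v] -> X != set0 -> X = [set v].
  by rewrite subset1 => /orP[/eqP//|/eqP->]; rewrite eqxx.
have bv : b :&: In [set v] = b.
  by apply/setIidPl; apply: subset_trans sb (subsetIr _ _).
apply/existsP; exists b; rewrite subxx andbT; apply/tkP; split.
- exact: subset_trans sb (subsetIl _ _).
- move=> a /(subsetP sb); rewrite !inE => /and3P[_ sa ta]; split=> //.
  by apply: contraNneq sa => ->.
- by move=> X sX nX; rewrite (eX X) // bv (eqP cb).
- by move=> X _ sX nX; rewrite (eX X) // bv (eqP cb).
Qed.

(** Both properties are proved together and for all [E], since [arc_swap] at [U] needs on the parts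
    the rank axioms, for [E] and for [h |: E], as well as the bound on the change of rank. *)
Lemma tbase_exchange U E : U \in L -> U != set0 -> exchange E U /\ arc_swap E U.
Proof.
have [n] := ubnP #|U|; elim: n U E => // n IH U E; rewrite ltnS => leU UL nU.
have [U_gt1|U_le1] := ltnP 1 #|U|; last first.
  have /cards1P[v eU] : #|U| == 1 by rewrite eqn_leq U_le1 card_gt0.
  rewrite {}eU in UL *; split.
    move=> b0 b1 K bb0 bb1 sK.
    have le1 : k - #|K| <= #|b1 :\: K|.
      rewrite leq_subLR -(tbase_card bb1) -(cardsID K b1) leq_add2r.
      exact/subset_leq_card/subsetIr.
    have [J sJ cJ] := subset_of_card le1; exists J.
      exact: subset_trans sJ (subsetDl _ _).
    rewrite single_tbase // subUset (subset_trans sK (tbase_sub bb0)).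
    rewrite (subset_trans sJ) ?(subset_trans (subsetDl _ _) (tbase_sub bb1)) //=.
    rewrite cardsU (_ : K :&: J = set0) ?cards0 ?subn0 ?cJ ?subnKC //.
      by rewrite -(tbase_card bb0) subset_leq_card.
    apply/setP=> a; rewrite !inE; apply/negP=> /andP[aK /(subsetP sJ)].
    by rewrite inE aK.
  move=> h b0 b bb0 bb.
  have le1 : k - #|b :&: E| <= #|b0 :\: (b :&: E)|.
    rewrite leq_subLR -(tbase_card bb0) -(cardsID (b :&: E) b0) leq_add2r.
    exact/subset_leq_card/subsetIr.
  have [J sJ cJ] := subset_of_card le1; exists (b :&: E :|: J).
    rewrite single_tbase // subUset.
    rewrite (subset_trans sJ) ?(subset_trans (subsetDl _ _) (tbase_sub bb0)) // andbT.
    apply/andP; split.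
      by rewrite setIC; apply/setIS/(subset_trans (tbase_sub bb))/subsetIr.
    rewrite cardsU (_ : b :&: E :&: J = set0) ?cards0 ?subn0 ?cJ ?subnKC //.
      by rewrite -(tbase_card bb) subset_leq_card ?subsetIl.
    apply/setP=> a; rewrite in_setI in_set0; apply/negP=> /andP[aK /(subsetP sJ)].
    by rewrite inE aK.
  rewrite -(cards1 h) subset_leq_card //; apply/subsetP=> a.
  rewrite !inE => /andP[/norP[nE _] ab]; move: (subsetP (tbase_sub bb) a ab) nE.
  by rewrite ab !inE => /andP[/orP[->|->]].
have sing v : v \in U -> [set v] \in L by apply: singL.
have IHC E' U' : U' \in max_parts L U -> exchange E' U' /\ arc_swap E' U'.
  case/(max_partsP sing U_gt1) => U'L sU' nU' nU'0; apply: IH => //.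
  by apply: leq_trans leU; apply: proper_card; rewrite properEneq nU'.
have rankE E' U' : U' \in max_parts L U -> rank_fun (trank E' U').
  by case/(IHC E') => /exchange_rank_fun.
split; first by apply: exchange_step => // U'; apply: rankE.
move=> h b0 b bb0 bb; apply: (arc_swap_step UL U_gt1 bb0) bb; try by move=> U'; apply: rankE.
move=> U' Z U'C; have [F tF _] := tbase_ext bb0 UL nU.
have [U'L sU' _ nU'] := max_partsP sing U_gt1 U'C.
apply: trank_add_arc (tk_base tF U'L sU' nU') => //.
by case: (IHC E U' U'C).
Qed.

End Core.

(** * Minimal blockers *)

Section Blockers.
Variables (V A : finType) (k : nat) (D : digraph V A) (L : {set {set V}}).
Hypothesis k_gt0 : 0 < k.
Hypothesis L_sub : L \subset powerset (nodes D).
Hypothesis L_laminar : laminar L.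
Hypothesis L_singletons : forall v, v \in nodes D -> [set v] \in L.
Local Notation B := (plus_arc D k).
Local Notation s := (@plus_src V A D k).
Local Notation t := (@plus_tgt V A D k).
Local Notation tk := (tk k L s t).
Local Notation In X := (delta s t (up X)).
Local Notation E H := (arcs (plus_minus D k H)).
Implicit Types (U W X : {set V}) (H : {set A}) (F b Q : {set B}).

Let subV U : U \in L -> U \subset nodes D.
Proof. by move/(subsetP L_sub); rewrite inE. Qed.

Let singL U v : U \in L -> v \in U -> [set v] \in L.
Proof. by move=> UL vU; apply/L_singletons/(subsetP (subV UL)). Qed.

Lemma tight_rooted_plusE H U F : U \in L ->
  tight_rooted k L (plus_minus D k H) U F = tk (E H) U F.
Proof.
move=> UL; apply: tight_rootedE; last by move=> v; apply: singL.
  by rewrite !inE.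
by apply: subset_trans (subsetUr _ _); rewrite upS subV.
Qed.

Lemma has_tight_rooted_plusE H U : U \in L ->
  has_tight_rooted k L (plus_minus D k H) U = [exists F : {set B}, tk (E H) U F].
Proof. by move=> UL; apply: eq_existsb => F; apply: tight_rooted_plusE. Qed.

Lemma is_base_plusE H U b : U \in L ->
  is_base k L (plus_minus D k H) U b = tbase s t k L (E H) U b.
Proof.
move=> UL; rewrite /is_base /tbase.
have -> : in_arcs (plus_minus D k H) (up U) = E H :&: In U.
  by apply/setP=> a; rewrite in_setI !in_set.
by congr [&& _, _ & _]; apply: eq_existsb => F; rewrite tight_rooted_plusE.
Qed.

Lemma rank_plusE H U Q : U \in L ->
  rank k L (plus_minus D k H) U Q = trank s t k L (E H) U Q.
Proof.
move=> UL; apply/eqP; rewrite eqn_leq; apply/andP; split; apply/bigmax_leqP.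
  move=> J /andP[sJ /existsP[b /andP[bb sJb]]]; rewrite is_base_plusE // in bb.
  by apply: leq_trans (trank_ge Q bb); rewrite subset_leq_card // subsetI sJ.
move=> b bb; apply: (bigmax_sup (Q :&: b)) => //; rewrite subsetIl /=.
by apply/existsP; exists b; rewrite is_base_plusE // bb subsetIr.
Qed.

(** No arc of D^+ enters [None], so every spanning arborescence is rooted there. *)
Lemma k_arborescence_plus F :
  k_arborescence k (plus_graph D k) F = rooted_k_arborescence k None (plus_graph D k) F.
Proof.
apply: eq_existsb => T; congr (_ && _); apply: eq_forallb => i.
rewrite /rooted_arborescence; case: (arborescence _ _) => //=; rewrite !inE /=.
by apply/esym/forallP=> a; apply/implyP=> _; case: a.
Qed.

Lemma tight_plusE F :
  k_arborescence k (plus_graph D k) F && tight k (upF L) (plus_graph D k) F =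
  tk (arcs (plus_graph D k)) (nodes D) F.
Proof.
have eL : upF L = upF (below L (nodes D)).
  rewrite (_ : below L (nodes D) = L) //; apply/setP=> X; rewrite inE.
  by have [/subV->|] := boolP (X \in L).
rewrite k_arborescence_plus eL; apply/andP/idP => [[rF tF]|tF].
  exact: (tight_rooted_tk (Q := plus_graph D k) erefl rF tF).
exact: (tk_tight_rooted (Q := plus_graph D k) erefl L_singletons tF).
Qed.

Lemma blockingP H : reflect (H \subset arcs D /\
  forall F, tk (arcs (plus_graph D k)) (nodes D) F -> exists2 a, a \in H & inl a \in F)
  (blocking D k L H).
Proof.
apply: (iffP andP) => -[sH h]; split=> //.
  by move=> F tF; move/forallP: h => /(_ F); rewrite tight_plusE tF => /exists_inP.
by apply/forallP=> F; apply/implyP; rewrite tight_plusE => /h/exists_inP.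
Qed.

Lemma tk_subset (E1 E2 : {set B}) U F : tk E1 U F -> F \subset E2 -> tk E2 U F.
Proof. by case/tkP=> _ ? ? ? ?; apply/tkP. Qed.

Lemma arcs_plus_minus H : E H = arcs (plus_graph D k) :\: [set inl a | a in H].
Proof. by []. Qed.

Lemma root_arc_plus_minus H v i : (inr (v, i) \in E H) = (v \in nodes D).
Proof.
rewrite arcs_plus_minus in_setD inE /=; case: (v \in nodes D); rewrite ?andbF // andbT.
by apply/imsetP=> -[].
Qed.

(* Adding to each of the [k] arborescences an arc from the new node to its root. *)
Lemma tight_plus_exists (F0 : {set A}) : nodes D != set0 -> k_arborescence k D F0 -> tight k L D F0 ->
  exists F, tk (arcs (plus_graph D k)) (nodes D) F.
Proof.
case/set0Pn=> v0 v0D /existsP[T /and3P[/forallP arbT /forallP disjT /eqP eF0]] tF0.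
have {}disjT i j : i != j -> [disjoint T i & T j].
  by move=> ij; move/forallP: (disjT i) => /(_ j); rewrite ij.
have arb i : [/\ T i \subset arcs D, connected D (T i), acyclic D (T i) &
    forall v, v \in nodes D -> indeg D (T i) v <= 1].
  case/andP: (arbT i) => /and3P[sT cT aT] /forallP deg; split=> //.
  by move=> v vN; have := deg v; rewrite vN.
have rootT i : {r | (r \in nodes D) && [forall a in T i, tgt D a != r]}.
  apply: sigW; case: (arb i) => sT _ aT _; have [r rD rT] := acyclic_root sT aT v0D.
  by exists r; rewrite rD; apply/forallP=> a; apply/implyP/rT.
pose r i := sval (rootT i).
have rP i : r i \in nodes D /\ forall a, a \in T i -> tgt D a != r i.
  have /andP[-> /forallP h] := svalP (rootT i); split=> // a aT.
  by have := h a; rewrite aT.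
(* The [i]-th root arc uses its own copy, so the arborescences stay disjoint when roots coincide. *)
pose e i : B := inr (r i, rshift #|arcs D| i).
pose Tp i : {set B} := e i |: [set inl a | a in T i].
have memTp i a : (inl a \in Tp i) = (a \in T i).
  by rewrite !inE /= mem_imset //; move=> ? ? [].
have memTpr i p : (inr p \in Tp i) = (inr p == e i).
  rewrite !inE (_ : (inr p \in _) = false) ?orbF //.
  by apply/imsetP=> -[].
have sF0 : F0 \subset arcs D by rewrite eF0; apply/bigcupsP=> i _; case: (arb i).
have disjTp i j : i != j -> [disjoint Tp i & Tp j].
  move=> ij; rewrite -setI_eq0; apply/eqP/setP=> -[a|p]; rewrite in_setI in_set0.
    by rewrite !memTp; apply/negP=> /andP[ai aj]; rewrite (disjointFr (disjT i j ij) ai) in aj.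
  rewrite !memTpr; apply/negP=> /andP[/eqP-> /eqP[_ /addnI eij]].
  by rewrite (val_inj eij) eqxx in ij.
pose F : {set B} := \bigcup_i Tp i.
have F0F a : a \in F0 -> inl a \in F.
  by rewrite eF0 => /bigcupP[i _ aT]; apply/bigcupP; exists i; rewrite // memTp.
exists F; apply: (tk_intro (Q := plus_graph D k)).
- apply/bigcupsP=> i _; apply/subsetP=> -[a|p]; rewrite ?memTp ?memTpr.
    by case: (arb i) => sT _ _ _ /(subsetP sT); rewrite inE.
  by move=> /eqP->; rewrite inE /=; case: (rP i).
- move=> a /bigcupP[i _]; case: a => [a|p]; rewrite ?memTp ?memTpr.
    by case: (arb i) => sT _ _ _ /(subsetP sT)/arcs_ends/andP[_ ta]; rewrite mem_up.
  by move=> /eqP->; rewrite mem_up; case: (rP i).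
- move=> X sX nX; rewrite -card_disjoint_family // -[leqLHS]card_ord -sum1_card.
  apply: leq_sum => i _; have [rX|rX] := boolP (r i \in X).
    apply/card_gt0P; exists (e i); rewrite in_setI memTpr eqxx inE.
    by rewrite None_up mem_up.
  have [sT cT _ deg] := arb i; have [rD rT] := rP i.
  have /card_gt0P[a] := connected_enters sT cT deg rD rT sX rX nX.
  rewrite in_setI inE => /and3P[aT sa ta]; apply/card_gt0P; exists (inl a).
  by rewrite in_setI memTp aT inE !mem_up sa.
- move=> v vD; rewrite setIdE -card_disjoint_family // -[leqRHS]card_ord -sum1_card.
  apply: leq_sum => i _; have [_ _ _ deg] := arb i; have [_ rT] := rP i.
  apply/card_le1_eqP => -[a|p] [b|q]; rewrite !in_setI ?memTp ?memTpr !inE.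
  + move=> /andP[aT /eqP[ta]] /andP[bT /eqP[tb]]; congr inl.
    exact: indeg_le1P (deg v vD) bT aT tb ta.
  + by move=> /andP[aT /eqP[ta]] /andP[/eqP-> /eqP[tb]]; move: (rT a aT); rewrite ta tb eqxx.
  + by move=> /andP[/eqP-> /eqP[tb]] /andP[aT /eqP[ta]]; move: (rT b aT); rewrite ta tb eqxx.
  + by move=> /andP[/eqP-> _] /andP[/eqP-> _].
- move=> X XL sX nX.
  have : k_arborescence k (induced D X) (F0 :&: arcs (induced D X)).
    by move/forallP: tF0 => /(_ X)/implyP; apply.
  case/existsP=> T' /and3P[/forallP arbT' /forallP disjT' /eqP eF'].
  have {}disjT' i j : i != j -> [disjoint T' i & T' j].
    by move=> ij; move/forallP: (disjT' i) => /(_ j); rewrite ij.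
  have nX' : nodes (induced D X) = X by apply/setIidPr.
  have : k * #|X| <= #|F0 :&: arcs (induced D X)| + k.
    rewrite eF' -[\bigcup_i _]setIT -card_disjoint_family //.
    rewrite mulnC -sum_nat_const -[X in _ <= _ + X]card_ord -sum1_card -big_split /=.
    rewrite sum_nat_const mulnC -[X in X * _ <= _](card_ord k) -sum_nat_const.
    apply: leq_sum => i _; rewrite setIT addn1 -[in X in X <= _]nX'.
    case/andP: (arbT' i) => /and3P[sT cT _] /forallP dg.
    by apply: connected_card => // v vN; have := dg v; rewrite vN.
  have injl : injective (inl : A -> B) by move=> ? ? [].
  move/leq_trans; apply; rewrite leq_add2r -(card_imset _ injl).
  apply/subset_leq_card/subsetP=> _ /imsetP[a + ->]; rewrite !inE => /and4P[aF0 _ sa ta].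
  by rewrite F0F //= !mem_up sa.
Qed.

(** Of an arc entering [W] only the head matters for cuts inside [W], so an arc from [None] with the
    same head can replace it. Such arcs are never deleted, and at most [k] copies are needed at a
    node. *)
Lemma root_arcs_swap (E1 : {set B}) H W F : W \in L -> W != set0 -> tk E1 W F ->
  F :\: In W \subset E H ->
  exists F', tk (E H) W F' /\ (forall a, a \in F' :&: In W -> s a = None).
Proof.
move=> WL nW tF sFE; case/tkP: (tF) => sF endF ge le.
pose S := F :&: In W; have cS : #|S| <= k by apply: le.
have n_gt0 : 0 < #|arcs D| + k by rewrite addn_gt0 k_gt0 orbT.
have idx a : a \in S -> index a (enum S) < #|arcs D| + k.
  move=> aS; apply: leq_trans (leq_addl _ _); apply: leq_trans cS.
  by rewrite cardE index_mem mem_enum.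
pose o a : 'I_(#|arcs D| + k) := insubd (Ordinal n_gt0) (index a (enum S)).
pose phi a : B := if t a is Some v then inr (v, o a) else a.
have phiP a : a \in S -> exists2 v, v \in W & t a = Some v /\ phi a = inr (v, o a).
  rewrite inE => /andP[aF _]; have [+ _] := endF a aF; rewrite /phi.
  by case: (t a) => [v|]; rewrite ?None_up // mem_up; exists v.
have tphi a : a \in S -> t (phi a) = t a by case/phiP=> v _ [-> ->].
have sphi a : a \in S -> s (phi a) = None by case/phiP=> v _ [_ ->].
have phi_inj : {in S &, injective phi}.
  move=> a b aS bS; have [v _ [_ ->]] := phiP a aS; have [w _ [_ ->]] := phiP b bS.
  case=> _ /(congr1 val); rewrite !val_insubd !idx // => eab.
  have aE : a \in enum S by rewrite mem_enum.
  by rewrite -(nth_index a aE) eab nth_index // mem_enum.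
have phiW a : a \in S -> phi a \in In W.
  by move=> aS; move: (aS); rewrite !inE sphi // tphi // None_up => /and3P[_ _ ->].
pose F' := (F :\: In W) :|: phi @: S.
have cardF' X : X \subset W -> #|F' :&: In X| = #|F :&: In X|.
  move=> sX.
  have XW a : a \in F -> a \in In X -> (a \in In W) = (s a \notin up W).
    move=> _; rewrite !inE => /andP[_ ta].
    by rewrite (subsetP _ _ ta) ?andbT // upS.
  rewrite -(cardsID (In W) (F' :&: In X)) -(cardsID (In W) (F :&: In X)) addnC [RHS]addnC.
  congr (_ + _).
    apply: eq_card => a; rewrite !in_setD !in_setI in_setU in_setD.
    case aW: (a \in In W) => //=; rewrite (_ : (a \in phi @: S) = false) ?orbF //.
    by apply/imsetP=> -[b bS eab]; rewrite eab phiW in aW.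
  have -> : F' :&: In X :&: In W = phi @: (S :&: In X).
    apply/setP=> a; rewrite !in_setI in_setU in_setD.
    apply/idP/imsetP => [/andP[/andP[+ aX] aW]|[b]].
      rewrite aW /= => /imsetP[b bS eab]; exists b => //; rewrite in_setI bS.
      move: (aX) (bS); rewrite eab !inE tphi // => /andP[_ ->] /and3P[_ sb _].
      by rewrite andbT; apply: contra sb; apply: subsetP; rewrite upS.
    rewrite in_setI => /andP[bS bX] ->; rewrite phiW // imset_f // orbT andbT /=.
    by move: bX; rewrite !inE sphi // tphi // None_up => /andP[_ ->].
  rewrite card_in_imset; last first.
    by move=> a b; rewrite !in_setI -!in_setI => /setIP[aS _] /setIP[bS _]; apply: phi_inj.
  by apply: eq_card => a; rewrite !in_setI andbAC.
exists F'; split; last first.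
  move=> a; rewrite in_setI in_setU in_setD => /andP[+ aW]; rewrite aW /=.
  by case/imsetP=> b bS ->; apply: sphi.
apply/tkP; split.
- rewrite subUset sFE; apply/subsetP=> _ /imsetP[a aS ->].
  by have [v vW [_ ->]] := phiP a aS; rewrite root_arc_plus_minus (subsetP (subV WL)).
- move=> a; rewrite in_setU in_setD => /orP[/andP[_ /endF//]|/imsetP[b bS ->]].
  rewrite tphi // sphi //; have [v vW [-> _]] := phiP b bS.
  by rewrite mem_up.
- by move=> X sX nX; rewrite cardF' //; apply: ge.
- by move=> X XL sX nX; rewrite cardF' //; apply: le.
Qed.

Lemma single_feasible H v : v \in nodes D -> exists F, tk (E H) [set v] F.
Proof.
move=> vD; pose b : {set B} := [set inr (v, rshift #|arcs D| i) | i : 'I_k].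
have : tbase s t k L (E H) [set v] b.
  rewrite single_tbase ?L_singletons //; apply/andP; split.
    apply/subsetP=> _ /imsetP[i _ ->]; rewrite in_setI root_arc_plus_minus vD inE /=.
    by rewrite None_up mem_up inE eqxx.
  by rewrite card_imset ?card_ord // => i j [] /addnI/val_inj.
case/tbase_ext; rewrite ?L_singletons //; first by apply/set0Pn; exists v; rewrite inE.
by move=> F tF _; exists F.
Qed.

(** * A minimal blocker and a minimal infeasible member *)

Section Minimal.
Variables (H : {set A}) (W : {set V}).
Hypothesis D_tight : exists F : {set A}, k_arborescence k D F /\ tight k L D F.
Hypothesis H_min : minset (fun H' : {set A} => blocking D k L H') H.
Hypothesis W_min : minset (fun U => (U \in L) && ~~ has_tight_rooted k L (plus_minus D k H) U) W.
Local Notation C := (max_parts L W).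
Local Notation hd := (fun a => part_of L W (t a)).
Local Notation tl := (fun a => part_of L W (s a)).
Local Notation inner := [set a : B | (s a \in up W) && (t a \in up W)].
Local Notation rk := (trank s t k L (E H)).
Local Notation f := (cutrank hd tl rk inner).

Lemma minimal_infeasible : W \in L /\ forall F, ~~ tk (E H) W F.
Proof.
have /minsetp/andP[WL] := W_min; rewrite has_tight_rooted_plusE // => /existsPn h.
by split.
Qed.

Lemma smaller_feasible U : U \in L -> U \subset W -> U != W -> exists F, tk (E H) U F.
Proof.
move=> UL sU nU; apply/existsP; rewrite -has_tight_rooted_plusE //.
apply: contraNT nU => infeas; have /minsetP[_ minW] := W_min.
by apply/eqP/minW => //; rewrite UL.
Qed.

Lemma infeasible_gt1 : 1 < #|W|.
Proof.
have [WL noF] := minimal_infeasible; rewrite ltnNge; apply/negP=> le1.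
have [W0|nW] := eqVneq W set0.
  have /negP[] := noF set0; apply/tkP; split; first exact: sub0set.
  - by move=> a; rewrite inE.
  - by move=> X; rewrite W0 subset0 => ->.
  - by move=> X _; rewrite W0 subset0 => ->.
have /cards1P[v eW] : #|W| == 1 by rewrite eqn_leq le1 card_gt0.
have [|F tF] := @single_feasible H v; last by have := noF F; rewrite eW tF.
by apply: (subsetP (subV WL)); rewrite eW inE.
Qed.

Lemma infeasible_neq0 : W != set0. Proof. by rewrite -card_gt0 ltnW // infeasible_gt1. Qed.

Lemma blocker_neq0 : exists h, h \in H.
Proof.
have /minsetp/blockingP[_ block] := H_min; have [WL _] := minimal_infeasible.
have nD : nodes D != set0.
  by apply: contraNneq infeasible_neq0 => D0; rewrite -subset0 -D0 subV.
have [F0 [aF0 tF0]] := D_tight; have [F tF] := tight_plus_exists nD aF0 tF0.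
by have [a aH _] := block F tF; exists a.
Qed.

(** By minimality some tight k-arborescence of D^+ avoids [H :\ h]; it restricts to [W]. *)
Lemma blocker_restore h : h \in H -> exists F, tk (inl h |: E H) W F.
Proof.
move=> hH; have [WL _] := minimal_infeasible; have /minsetP[/blockingP[sH _] minH] := H_min.
have : ~~ blocking D k L (H :\ h).
  apply/negP=> /minH/(_ (subsetDl _ _)) eH.
  by move: hH; rewrite -eH !inE eqxx.
rewrite /blocking (subset_trans (subsetDl _ _) sH) /= negb_forall => /existsP[F].
rewrite negb_imply tight_plusE => /andP[tF /exists_inPn nF].
have sFE : F \subset inl h |: E H.
  apply/subsetP=> a aF; rewrite in_setU1 arcs_plus_minus in_setD.
  have -> : a \in arcs (plus_graph D k) by case/tkP: tF => sF _ _ _; apply: subsetP aF.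
  rewrite andbT; apply/orP; case: eqP => [|nah]; [by left|right].
  apply/imsetP=> -[b bH eab]; have := nF b; rewrite -eab aF => /(_ _)/negP; apply=> //.
  by rewrite !inE bH andbT; apply/eqP=> bh; apply: nah; rewrite eab bh.
have bb := tk_base (tk_subset tF sFE) WL (subV WL) infeasible_neq0.
by have [F' tF' _] := tbase_ext bb WL infeasible_neq0; exists F'.
Qed.

(** A packing made possible by restoring [h] must use [h], so the head is in [W]. Were the tail
    outside, [h] could be exchanged for an arc from [None], making [W] feasible without it. *)
Lemma blocker_inside h : h \in H -> src D h \in W /\ tgt D h \in W.
Proof.
move=> hH; have [WL noF] := minimal_infeasible; have [F tF] := blocker_restore hH.
case/tkP: (tF) => sF endF _ _.
have hF : inl h \in F.
  apply: contraT => hF; have /negP[] := noF F; apply: tk_subset tF _.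
  apply/subsetP=> a aF; move: (subsetP sF a aF); rewrite in_setU1 => /orP[/eqP ah|//].
  by rewrite -ah aF in hF.
have [th _] := endF _ hF; rewrite mem_up in th; split=> //.
apply: contraT => sh; have [||F' [tF' _]] := @root_arcs_swap _ H W F WL _ tF.
- exact: infeasible_neq0.
- apply/subsetP=> a; rewrite in_setD => /andP[aW /(subsetP sF)].
  rewrite in_setU1 => /orP[/eqP ah|//]; move: aW.
  by rewrite ah inE /= !mem_up sh th.
- by have := noF F'; rewrite tF'.
Qed.

Let singW v : v \in W -> [set v] \in L.
Proof. by case: minimal_infeasible => WL _; apply: singL. Qed.

Lemma infeasible_parts U : U \in C -> [/\ U \in L, U \subset W, U != W & U != set0].
Proof. exact: (max_partsP singW infeasible_gt1). Qed.

Lemma rank_parts (E1 : {set B}) U : U \in C -> rank_fun (trank s t k L E1 U).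
Proof.
case/infeasible_parts=> UL _ _ nU; apply: exchange_rank_fun.
by case: (tbase_exchange s t k_gt0 L_laminar singL E1 UL nU).
Qed.

(* The paper's min-max deficiency: [root arcs needed] - [root arcs allowed] is
   positive since [W] is infeasible, and at most one since restoring any arc of
   [H] makes [W] feasible. *)
Lemma tight_subpartition : exists P : {set {set {set V}}},
  [/\ trivIset P, set0 \notin P, cover P \subset C & (\sum_(X in P) f X) + k.+1 = k * #|P|].
Proof.
have [WL noF] := minimal_infeasible.
pose R := [set a in E H | (s a == None) && (t a \in up W)].
have RW : R \subset E H :&: In W.
  by apply/subsetP=> a; rewrite in_setI !in_set => /and3P[-> /eqP-> ->]; rewrite None_up.
have rootIn a : a \in In W -> tl a \notin C.
  by apply: root_entering => //; apply: infeasible_gt1.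
have rootR a : a \in R -> tl a \notin C.
  by move/(subsetP RW); rewrite in_setI => /andP[_ /rootIn].
have feas U : U \in C -> exists F, tk (E H) U F.
  by case/infeasible_parts=> UL sU nU _; apply: smaller_feasible.
(* Any part in [Q] is feasible by minimality of [W], with a base made of arcs from [None]; these
   also enter the union of [Q], so this part alone contributes [k]. *)
have okR : kconn hd tl C k rk (inner :|: R).
  apply/kconnP=> Q sQ /set0Pn[U UQ]; have UC := subsetP sQ _ UQ.
  have [UL sU _ nU] := infeasible_parts UC; have [F tF] := feas U UC.
  have [F' [tF' rF']] : exists F', tk (E H) U F' /\ (forall a, a \in F' :&: In U -> s a = None).
    apply: (root_arcs_swap UL nU tF); apply: subset_trans (subsetDl _ _) _.
    by case/tkP: tF.
  have bb := tk_base tF' UL (subxx _) nU.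
  apply: (@leq_trans #|F' :&: In U|); first by rewrite (tbase_card bb).
  rewrite /cutrank (bigD1 U) //=; apply: leq_trans (leq_addr _ _).
  apply: leq_trans (trank_ge _ bb); apply/subset_leq_card/subsetP=> a aF'.
  have sa := rF' a aF'; have /setIP[aF aU] := aF'.
  have ta : t a \in up U by move: aU; rewrite inE => /andP[].
  have taW : t a \in up W by apply: subsetP ta; rewrite upS.
  have aE : a \in E H by case/tkP: tF' => sF' _ _ _; apply: (subsetP sF').
  rewrite in_setI aF' andbT in_setI (cut_part s t L_laminar singL WL infeasible_gt1 sQ UQ).
  apply/andP; split; last by rewrite in_set ta sa None_up.
  by rewrite in_setU; apply/orP; right; rewrite /R in_set aE sa taW eqxx.
have [J [sJ okJ [P [tP nP sP leJ]]]] := min_root_arcs (@rank_parts _) rootR okR.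
exists P; split=> //; apply/eqP; rewrite eqn_leq; apply/andP; split.
  (* With at most [k] arcs [J] would be a base and [W] feasible; hence [#|J|] is at least [k.+1]. *)
  apply: leq_trans leJ; rewrite addnC leq_add2r ltnNge; apply/negP=> leJk.
  have bJ : tbase s t k L (E H) W J.
    apply: (kconn_base (L := L) k_gt0 L_laminar singL WL infeasible_gt1 (@rank_parts _)) => //.
    exact: subset_trans sJ RW.
  have [F tF _] := tbase_ext bJ WL infeasible_neq0.
  by have := noF F; rewrite tF.
(* Conversely, with [h] restored [k] entering arcs suffice, and this raises the sum of the ranks
   over [P] by at most one. *)
have [h hH] := blocker_neq0; have [F tF] := blocker_restore hH.
have bb := tk_base tF WL (subxx _) infeasible_neq0.
have ok := base_kconn L_laminar singL WL infeasible_gt1 (@rank_parts _) bb.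
apply: leq_trans (root_arcs_ge (@rank_parts _) tP nP sP ok) _.
rewrite (tbase_card bb) addnC addnS -addSn leq_add2r -addn1.
apply: leq_trans (_ : _ <= \sum_(X in P) (f X + (hd (inl h) \in X))) _; last first.
  by rewrite big_split /= leq_add2l sum_mem_trivIset.
apply: leq_sum => X XP; apply: cutrank_add_arc => //.
- exact: infeasible_gt1.
- by apply: subset_trans sP; apply: bigcup_sup XP.
- move=> U Z UC; have [UL _ _ nU] := infeasible_parts UC; have [F' tF'] := feas U UC.
  apply: trank_add_arc (tk_base tF' UL (subxx _) nU) => //.
  by case: (tbase_exchange s t k_gt0 L_laminar singL (E H) UL nU).
Qed.

Lemma cutrank_rank_sum (X : {set {set V}}) : X \subset C ->
  rank_sum L (plus_minus D k H) W
    (in_arcs (induced (plus_minus D k H) (up W)) (up (cover X))) = f X.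
Proof.
move=> sX; rewrite /rank_sum /cutrank (bigID (mem X)) /= [X in _ + X]big1 ?addn0.
  apply: eq_big => [U|U /andP[UC UX]].
    by have [/(subsetP sX)->|] := boolP (U \in X); rewrite ?andbF.
  have [UL sU _ _] := infeasible_parts UC.
  rewrite rank_plusE // -[RHS]trank_setI; congr trank.
  have sUX : up U \subset up (cover X) by rewrite upS; apply: bigcup_sup UX.
  have [WL _] := minimal_infeasible; apply/setP=> a.
  rewrite !in_setI (cut_part s t L_laminar singL WL infeasible_gt1 sX UX).
  rewrite !in_set /=.
  have [ta|] := boolP (t a \in up U); rewrite ?andbF //=.
  rewrite (subsetP sUX _ ta) !andbT /=.
  have [sa|sa] := boolP (s a \in up (cover X)); rewrite /= ?andbF // !andbT.
  have -> : s a \notin up U by apply: contra sa; apply: (subsetP sUX).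
  have -> : (match a with inl a0 => a0 \in arcs D | inr p => p.1 \in nodes D end) =
            (a \in plus_arcs D k) by rewrite inE.
  rewrite /= !andbT andbC andbA.
  by case: (a \notin _); case: (a \in _); case: (s a \in _); case: (t a \in _).
(* A part outside [X] contributes nothing, as arcs entering [cover X] have their heads in members of
   [X]. *)
move=> U /andP[UC UX]; have [UL _ _ _] := infeasible_parts UC.
rewrite rank_plusE //; apply/eqP; rewrite -leqn0 -(@cards0 B).
apply: leq_trans (trank_le_card _ _ _ _ _ _ _) _; rewrite cards0 leqn0 cards_eq0.
apply/eqP/setP=> a; rewrite in_setI in_set0; apply/negP=> /andP[aX aU].
have ta : t a \in up (cover X) by move: aX; rewrite inE => /and3P[].
have taU : t a \in up U by move: aU; rewrite inE => /and3P[].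
rewrite -(part_of_eq L_laminar singW infeasible_gt1 _ UC) in taU.
by move: ta; rewrite -(part_of_cover L_laminar singW infeasible_gt1) // (eqP taU) (negPf UX).
Qed.

End Minimal.
End Blockers.

(** * The subpartition of [W] and its value *)

Local Open Scope ring_scope.

Theorem theorem5p2 (V A : finType) (k : nat) (D : digraph V A)
    (L : {set {set V}}) (H : {set A}) (W : {set V})
    (k_gt0 : (0 < k)%N)
    (L_sub : L \subset powerset (nodes D))
    (L_laminar : laminar L)
    (L_top : nodes D \in L)
    (L_singletons : forall v : V, v \in nodes D -> [set v] \in L)
    (D_tight : exists F : {set A}, k_arborescence k D F /\ tight k L D F)
    (H_min : minset (fun H' : {set A} => blocking D k L H') H)
    (W_min : minset (fun U : {set V} =>
       (U \in L) && ~~ has_tight_rooted k L (plus_minus D k H) U) W) :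
  (forall a : A, a \in H -> (src D a \in W) /\ (tgt D a \in W)) /\
  exists P : {set {set V}},
    compatible_subpartition L W P /\
    (\sum_(X in P)
        rank_sum L (plus_minus D k H) W
          (in_arcs (induced (plus_minus D k H) (up W)) (up X)))%N%:Z
      = k%:Z * (#|P|%:Z - 1) - 1.
Proof.
have [WL _] := minimal_infeasible L_sub L_singletons W_min.
split; first by move=> a; apply: (blocker_inside k_gt0 L_sub L_singletons H_min W_min).
have W1 := infeasible_gt1 L_sub L_singletons W_min.
have singW v : v \in W -> [set v] \in L.
  by move=> vW; apply/L_singletons/(subsetP _ v vW); move/(subsetP L_sub): WL; rewrite inE.
have [P [tP nP sP eP]] :=
  tight_subpartition k_gt0 L_sub L_laminar L_singletons D_tight H_min W_min.
have sPX X : X \in P -> X \subset max_parts L W.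
  by move=> XP; apply: subset_trans sP; apply: bigcup_sup XP.
(* [P] consists of sets of parts, whereas sets of nodes are wanted; [cover] translates, preserving
   disjointness and the number of members because a node lies in one part only. *)
have meet X Y v : X \in P -> Y \in P -> v \in cover X -> v \in cover Y -> X = Y.
  move=> XP YP vX vY; apply/eqP; apply: contraT => /(trivIsetP tP _ _ XP YP) dXY.
  have pE Z : Z \in P -> (part_of L W (Some v) \in Z) = (v \in cover Z).
    by move=> ZP; rewrite (part_of_cover L_laminar singW W1) ?sPX // mem_up.
  have pX : part_of L W (Some v) \in X by rewrite pE.
  by have := disjointFr dXY pX; rewrite pE // vY.
have nonempty X : X \in P -> exists v, v \in cover X.
  move=> XP; have /set0Pn[U UX] : X != set0 by apply: contraNneq nP => <-.
  have [_ _ _ /set0Pn[v vU]] := max_partsP singW W1 (subsetP (sPX X XP) _ UX).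
  by exists v; apply/bigcupP; exists U.
have cover_inj : {in P &, injective (@cover V)}.
  by move=> X Y XP YP e; have [v vX] := nonempty X XP; apply: (meet X Y v); rewrite -?e.
have coverW X : X \in P -> cover X \subset W.
  move=> XP; apply/bigcupsP=> U /(subsetP (sPX X XP)) UC.
  by case: (max_partsP singW W1 UC).
exists [set cover X | X in P]; split.
  apply/andP; split; last first.
    apply/forall_inP=> _ /imsetP[X XP ->]; rewrite /compatible coverW //.
    by apply/existsP; exists X; rewrite sPX //=.
  apply/and3P; split.
  - apply/trivIsetP=> _ _ /imsetP[X XP ->] /imsetP[Y YP ->] nXY.
    rewrite -setI_eq0; apply/set0Pn=> -[v]; rewrite inE => /andP[vX vY].
    by rewrite (meet X Y v) ?eqxx in nXY.
  - by apply/imsetP=> -[X XP e]; have [v] := nonempty X XP; rewrite -e inE.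
  - by apply/bigcupsP=> _ /imsetP[X XP ->]; apply: coverW.
rewrite big_imset //= card_in_imset //.
(* The truncated subtraction is exact, since [eP] exhibits [k.+1] as a summand of [k * #|P|]. *)
have -> : (\sum_(X in P) rank_sum L (plus_minus D k H) W
    (in_arcs (induced (plus_minus D k H) (up W)) (up (cover X))) = k * #|P| - k.+1)%N.
  rewrite -eP addnK; apply: eq_bigr => X XP.
  exact: (cutrank_rank_sum L_sub L_laminar L_singletons W_min (sPX X XP)).
have lePk : (k.+1 <= k * #|P|)%N by rewrite -eP leq_addl.
move: (k * #|P|)%N lePk (PoszM k #|P|) => m lem em.
by rewrite mulrBr mulr1 -em -subzn // -addn1 PoszD opprD addrA.
Qed.
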